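(* Let $R$ be an F-finite regular ring of prime characteristic $p$, with ideals $\mathfrak{a},\mathfrak{b}$. Write $\tau(\mathfrak{a}^t)=\tau(R,\mathfrak{a}^t)$ for the test ideal. The following hold: (1) If $\mathfrak{a}\subseteq \mathfrak{b}$ then $\tau(R,\mathfrak{a}^t)\subseteq \tau(R,\mathfrak{b}^t)$ for all $t\in \mathbb{R}_{>0}$. (2) If $t\geq t'$ then $\tau(R,\mathfrak{a}^t)\subseteq \tau(R,\mathfrak{a}^{t'})$. (3) $\tau((\mathfrak{a}^n)^t)=\tau(\mathfrak{a}^{nt})$ for each positive integer $n$ and each $t\in\mathbb{R}_{> 0}$. (4) If $W$ is a multiplicatively closed set in $R$, then $\tau(R,\mathfrak{a}^t)RW^{-1}=\tau(RW^{-1},(\mathfrak{a} RW^{-1})^t)$. (5) If $\overline{\mathfrak{a}}$ denotes the integral closure of $\mathfrak{a}$ in $R$, then $\tau(\overline{\mathfrak{a}}^t)=\tau(\mathfrak{a}^t)$ for all $t$. (6) For each $t\in \mathbb{R}_{> 0}$, there exists an $\varepsilon>0$ such that $\tau(\mathfrak{a}^{t'})=\tau(\mathfrak{a}^t)$ for all $t'\in [t,t+\varepsilon)$. (7) $\mathfrak{a}\subseteq \tau(\mathfrak{a})$, where $\tau(\mathfrak{a})=\tau(\mathfrak{a}^1)$. (8) (Briançon-Skoda Theorem) If $\mathfrak{a}$ can be generated by $r$ elements ($r\ge 1$), then for each integer $\ell\geq r$ we have $\tau(\mathfrak{a}^{\ell})=\mathfrak{a}\,\tau(\mathfrak{a}^{\ell-1})$.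 (9) (Restriction Theorem) Let $x\in R$ be a regular parameter and let $\mathfrak{a} \bmod x$ denote the image of $\mathfrak{a}$ in $R/(x)$. Then $\tau((\mathfrak{a} \bmod x)^t)\subseteq \tau(\mathfrak{a}^t) \bmod x$, where the left-hand test ideal is taken in $R/(x)$. (10) (Subadditivity Theorem) If $R$ is essentially of finite type over a perfect field, then $\tau(\mathfrak{a}^{tn})\subseteq \tau(\mathfrak{a}^t)^n$ for all $t\in \mathbb{R}_{\geq 0}$ and all $n \in \mathbb{N}$.
   Context: A ring $R$ of prime characteristic $p$ is F-finite if it is finitely generated as a module over its subring $R^p$ of $p$-th powers; regular rings are Noetherian. $R^{1/p^e}$ denotes the ring of $p^e$-th roots of elements of the reduced ring $R$, an $R$-module via $R\subset R^{1/p^e}$ (equivalently, $R$ viewed as a module over itself via the $e$-th iterated Frobenius), and for an ideal $\mathfrak{a}$, $\mathfrak{a}^{1/p^e}\subset R^{1/p^e}$ is the set of $p^e$-th roots of elements of $\mathfrak{a}$. Define the ideal of $R$ $$\mathfrak{a}^{[1/p^e]} := \sum_{\phi \in \mathrm{Hom}_R(R^{1/p^e}, R)} \phi(\mathfrak{a}^{1/p^e}).$$ For a non-negative rational number of the form $\frac{n}{p^e}$, the test ideal is $$\tau(\mathfrak{a}^{\frac{n}{p^e}}) := \bigcup_{f\ge 0} (\mathfrak{a}^{np^f})^{[1/p^{e+f}]},$$ an increasing union of ideals independent of the representation of the fraction (with $\mathfrak{a}^0=R$). For $t\in\mathbb{R}_{\geq 0}$, the test ideal is $$\tau(R,\mathfrak{a}^t)=\tau(\mathfrak{a}^t):=\bigcup_{e\in\mathbb{N}}\tau(\mathfrak{a}^{\frac{\lceil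 tp^e\rceil }{p^e}}),$$ again an increasing union. Exponents $t,t'$ are non-negative real numbers wherever not otherwise specified. A regular parameter $x\in R$ is a non-zerodivisor, non-unit element such that $R/(x)$ is again regular. *)

(* Defs.v *)
From HB Require Import structures.
From mathcomp Require Import all_boot all_order all_algebra.
From mathcomp Require Import generic_quotient ring_quotient.
From mathcomp Require Import all_classical all_reals.
From mathcomp Require Import ring.

Set Implicit Arguments.
Unset Strict Implicit.
Unset Printing Implicit Defensive.

Import Order.TTheory GRing.Theory Num.Theory.

Local Open Scope classical_set_scope.
Local Open Scope ring_scope.

(* Ideals are arbitrary [set R], so that the unit ideal is allowed (the        *)
(* library's [idealr] is restricted to proper ideals).  Rings may be trivial   *)
(* ([comPzRingType]), because a localization may be.                           *)
Section Ideals.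
Variable R : comPzRingType.
Implicit Types (I J A : set R).

Definition is_ideal I : Prop :=
  [/\ I 0, forall x y, I x -> I y -> I (x + y) & forall r x, I x -> I (r * x)].

Definition ideal_gen A : set R :=
  [set x | exists (n : nat) (r g : 'I_n -> R),
     (forall i, A (g i)) /\ x = \sum_(i < n) r i * g i].

Definition ideal_mul I J : set R :=
  [set x | exists (n : nat) (f g : 'I_n -> R),
     [/\ forall i, I (f i), forall i, J (g i) & x = \sum_(i < n) f i * g i]].

Definition ideal_exp I (n : nat) : set R := iter n (ideal_mul I) setT.

Definition generated_by I (r : nat) : Prop :=
  exists g : 'I_r -> R, I = ideal_gen (range g).

Definition integral_closure I : set R :=
  [set x | exists (n : nat) (c : nat -> R),
     [/\ (0 < n)%N,
         forall i, (1 <= i <= n)%N -> ideal_exp I i (c i) &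
         x ^+ n + \sum_(1 <= i < n.+1) c i * x ^+ (n - i) = 0]].

Definition prime_ideal I : Prop :=
  [/\ is_ideal I, ~ I 1 & forall x y, I (x * y) -> I x \/ I y].

Definition maximal_ideal I : Prop :=
  [/\ is_ideal I, ~ I 1 &
      forall J, is_ideal J -> ~ J 1 -> I `<=` J -> J = I].

Definition ring_unit (x : R) : Prop := exists y, x * y = 1.

End Ideals.

Definition noetherian (R : comPzRingType) : Prop :=
  forall I : set R, is_ideal I -> exists r, generated_by I r.

Definition prime_chain (R : comPzRingType) (n : nat) (P : nat -> set R) : Prop :=
  (forall i, (i <= n)%N -> prime_ideal (P i)) /\
  (forall i, (i < n)%N -> P i `<` P i.+1).

(* The dimension is exactly d, and in particular finite.                       *)
Definition krull_dim_eq (R : comPzRingType) (d : nat) : Prop :=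
  (exists P : nat -> set R, prime_chain d P) /\
  (forall n (P : nat -> set R), prime_chain n P -> (n <= d)%N).

(* The denominators W may contain zero divisors, and even 0, whence the extra  *)
(* factor w in [equiv]; [mulrClosed] includes 1 \in W.                         *)
Module Localization.
Section Localization.
Variables (R : comPzRingType) (W : mulrClosed R).
Local Open Scope quotient_scope.

Record frac := Frac { pair_of :> R * R; denom_in : pair_of.2 \in W }.

HB.instance Definition _ := [isSub for pair_of].
HB.instance Definition _ := [Choice of frac by <:].

Definition equiv (x y : frac) : bool :=
  `[< exists2 w, w \in W & w * (x.1 * y.2) = w * (y.1 * x.2) >].

Lemma equivP (x y : frac) :
  reflect (exists2 w, w \in W & w * (x.1 * y.2) = w * (y.1 * x.2)) (equiv x y).
Proof. exact: asboolP. Qed.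

Lemma equiv_refl : reflexive equiv.
Proof. by move=> x; apply/equivP; exists 1; rewrite ?rpred1. Qed.

Lemma equiv_sym : symmetric equiv.
Proof. by move=> x y; apply/equivP/equivP => -[w Ww e]; exists w. Qed.

Lemma equiv_trans : transitive equiv.
Proof.
move=> [[b v] /= Vv] [[a u] /= Wu] [[c z] /= Wz] /equivP[w1 /= W1 e1].
move=> /equivP[w2 /= W2 e2]; apply/equivP; exists (w1 * w2 * v) => /=.
  by rewrite !rpredM.
have -> : w1 * w2 * v * (a * z) = w2 * z * (w1 * (a * v)) by ring.
rewrite e1; have -> : w2 * z * (w1 * (b * u)) = w1 * u * (w2 * (b * z)) by ring.
by rewrite e2; ring.
Qed.

Canonical equiv_equiv := EquivRel equiv equiv_refl equiv_sym equiv_trans.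

Definition type := {eq_quot equiv}.

HB.instance Definition _ : EqQuotient _ equiv type := EqQuotient.on type.
HB.instance Definition _ := Choice.on type.

Definition mk (r : R) (w : R) (Ww : w \in W) : frac := @Frac (r, w) Ww.

Definition embed (r : R) : frac := mk r (rpred1 W).

Definition addf (x y : frac) : frac :=
  mk (x.1 * y.2 + y.1 * x.2) (rpredM (denom_in x) (denom_in y)).
Definition oppf (x : frac) : frac := mk (- x.1) (denom_in x).
Definition mulf (x y : frac) : frac :=
  mk (x.1 * y.1) (rpredM (denom_in x) (denom_in y)).

Definition tolocal (r : R) : type := \pi_type (embed r).
Definition add := lift_op2 type addf.
Definition opp := lift_op1 type oppf.
Definition mul := lift_op2 type mulf.

Lemma pi_eqP (x y : frac) :
  (\pi_type x = \pi_type y) <->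
  exists2 w, w \in W & w * (x.1 * y.2) = w * (y.1 * x.2).
Proof. by split=> [/eqmodP /equivP|/equivP h]; last exact/eqmodP. Qed.

Lemma repr_eq (x : frac) : exists2 w, w \in W &
  w * ((repr (\pi_type x)).1 * x.2) = w * (x.1 * (repr (\pi_type x)).2).
Proof. by apply/pi_eqP; rewrite reprK. Qed.

Lemma pi_add : {morph \pi : x y / addf x y >-> add x y}.
Proof.
move=> x y; unlock add; apply/pi_eqP.
have [w1 W1 e1] := repr_eq x; have [w2 W2 e2] := repr_eq y.
set x' := repr _ in e1 *; set y' := repr _ in e2 *.
exists (w1 * w2); first exact: rpredM.
rewrite /=.
have -> : w1 * w2 * ((x.1 * y.2 + y.1 * x.2) * (x'.2 * y'.2)) =
   w2 * y.2 * y'.2 * (w1 * (x.1 * x'.2)) + w1 * x.2 * x'.2 * (w2 * (y.1 * y'.2))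
  by ring.
by rewrite -e1 -e2; ring.
Qed.

Lemma pi_opp : {morph \pi : x / oppf x >-> opp x}.
Proof.
move=> x; unlock opp; apply/pi_eqP; have [w W1 e] := repr_eq x.
by exists w => //=; rewrite !mulNr !mulrN e.
Qed.

Lemma pi_mul : {morph \pi : x y / mulf x y >-> mul x y}.
Proof.
move=> x y; unlock mul; apply/pi_eqP.
have [w1 W1 e1] := repr_eq x; have [w2 W2 e2] := repr_eq y.
set x' := repr _ in e1 *; set y' := repr _ in e2 *.
exists (w1 * w2); first exact: rpredM.
rewrite /=.
have -> : w1 * w2 * (x.1 * y.1 * (x'.2 * y'.2)) =
   (w1 * (x.1 * x'.2)) * (w2 * (y.1 * y'.2)) by ring.
by rewrite -e1 -e2; ring.
Qed.

Lemma pi_ext (x y : frac) : x.1 * y.2 = y.1 * x.2 -> \pi_type x = \pi_type y.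
Proof. by move=> e; apply/pi_eqP; exists 1; rewrite ?rpred1 // e. Qed.

Lemma addA : associative add.
Proof.
elim/quotW=> x; elim/quotW=> y; elim/quotW=> z.
by rewrite -!pi_add; apply: pi_ext => /=; ring.
Qed.

Lemma addC : commutative add.
Proof.
elim/quotW=> x; elim/quotW=> y.
by rewrite -!pi_add; apply: pi_ext => /=; ring.
Qed.

Lemma add0l : left_id (tolocal 0) add.
Proof. by elim/quotW=> x; rewrite -!pi_add; apply: pi_ext => /=; ring. Qed.

Lemma addNl : left_inverse (tolocal 0) opp add.
Proof.
by elim/quotW=> x; rewrite -pi_opp -!pi_add; apply: pi_ext => /=; ring.
Qed.

HB.instance Definition _ := GRing.isZmodule.Build type addA addC add0l addNl.

Lemma mulA : associative mul.
Proof.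
elim/quotW=> x; elim/quotW=> y; elim/quotW=> z.
by rewrite -!pi_mul; apply: pi_ext => /=; ring.
Qed.

Lemma mulC : commutative mul.
Proof.
elim/quotW=> x; elim/quotW=> y.
by rewrite -!pi_mul; apply: pi_ext => /=; ring.
Qed.

Lemma mul1l : left_id (tolocal 1) mul.
Proof. by elim/quotW=> x; rewrite -!pi_mul; apply: pi_ext => /=; ring. Qed.

Lemma mulDl : left_distributive mul add.
Proof.
elim/quotW=> x; elim/quotW=> y; elim/quotW=> z.
by rewrite -!(pi_add, pi_mul); apply: pi_ext => /=; ring.
Qed.

HB.instance Definition _ :=
  GRing.Zmodule_isComPzRing.Build type mulA mulC mul1l mulDl.

Lemma tolocal_is_zmod_morphism : zmod_morphism tolocal.
Proof.
move=> x y; have e := pi_add (embed x) (oppf (embed y)).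
by rewrite pi_opp in e; apply: etrans e; apply: pi_ext => /=; ring.
Qed.

Lemma tolocal_is_monoid_morphism : monoid_morphism tolocal.
Proof.
split=> // x y; apply: etrans (pi_mul (embed x) (embed y)).
by apply: pi_ext => /=; ring.
Qed.

HB.instance Definition _ :=
  GRing.isZmodMorphism.Build R type tolocal tolocal_is_zmod_morphism.
HB.instance Definition _ :=
  GRing.isMonoidMorphism.Build R type tolocal tolocal_is_monoid_morphism.

End Localization.

End Localization.
HB.export Localization.

Notation localization W := (Localization.type W).
Notation tolocal W := (@Localization.tolocal _ W).

Lemma tolocal_eq0 (R : comPzRingType) (W : mulrClosed R) (r : R) :
  tolocal W r = 0 <-> exists2 w, w \in W & w * r = 0.
Proof.
rewrite -[0]/(tolocal W 0) Localization.pi_eqP /=.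
by split=> -[w Ww e]; exists w => //; move: e; rewrite mul0r mulr1 mulr0.
Qed.

Lemma tolocal_unit (R : comPzRingType) (W : mulrClosed R) (w : R) :
  w \in W -> ring_unit (tolocal W w).
Proof.
move=> Ww; exists (\pi_(localization W)%qT (Localization.mk 1 Ww)).
apply: etrans (esym (Localization.pi_mul _ _)) _.
by apply: Localization.pi_ext => /=; ring.
Qed.

Lemma tolocal_surj (R : comPzRingType) (W : mulrClosed R) (z : localization W) :
  exists r w, w \in W /\ tolocal W w * z = tolocal W r.
Proof.
elim/quotW: z => -[[r w] Ww]; exists r, w; split=> //.
apply: etrans (esym (Localization.pi_mul _ _)) _.
by apply: Localization.pi_ext => /=; ring.
Qed.

Section PrimeComplement.
Variables (R : comPzRingType) (P : set R) (hP : prime_ideal P).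

Definition prime_compl_pred of prime_ideal P : {pred R} := [pred x | x \notin P].

Lemma prime_compl_closed : mulr_closed (prime_compl_pred hP).
Proof.
have [_ P1 PM] := hP; split=> [|x y]; rewrite !inE ?notin_setE //.
by move=> Px Py /PM[].
Qed.

HB.instance Definition _ :=
  GRing.isMulClosed.Build R (prime_compl_pred hP) prime_compl_closed.

Definition prime_compl : mulrClosed R := prime_compl_pred hP.

End PrimeComplement.

Definition regular_local (S : comPzRingType) : Prop :=
  noetherian S /\
  exists (m : set S) (d : nat),
    [/\ maximal_ideal m, forall m', maximal_ideal m' -> m' = m,
        krull_dim_eq S d & generated_by m d].

Definition regular_ring (R : comPzRingType) : Prop :=
  noetherian R /\
  forall (P : set R) (hP : prime_ideal P),
    regular_local (localization (prime_compl hP)).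

Section QuotientByElement.
Variables (R : comNzRingType) (x : R) (hx : ~ ring_unit x).

Definition principal_pred of ~ ring_unit x : {pred R} :=
  [pred y | `[< exists r, y = r * x >]].

Lemma principal_idealr_closed : idealr_closed (principal_pred hx).
Proof.
split=> [||a u v].
- by apply/asboolP; exists 0; rewrite mul0r.
- by apply/asboolP => -[r e]; apply: hx; exists r; rewrite mulrC.
- move=> /asboolP[r ->] /asboolP[s ->]; apply/asboolP.
  by exists (a * r + s); rewrite mulrDl mulrA.
Qed.

HB.instance Definition _ :=
  isIdealr.Build R (principal_pred hx) principal_idealr_closed.

Definition principal : idealr R := principal_pred hx.

(* Together with hx: a nonzerodivisor, nonunit x with R/(x) regular.           *)
Definition regular_parameter : Prop :=
  GRing.lreg x /\ regular_ring {ideal_quot principal}.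

End QuotientByElement.

Definition F_finite (p : nat) (R : comPzRingType) : Prop :=
  exists (n : nat) (g : 'I_n -> R),
    forall x, exists c : 'I_n -> R, x = \sum_(i < n) c i ^+ p * g i.

Section TestIdeals.
Variables (p : nat) (R : comPzRingType).
Implicit Types (a : set R).

(* Under y^(1/p^e) <-> y, R^(1/p^e) is R with r acting as multiplication by    *)
(* r^(p^e), and a^(1/p^e) corresponds to a.                                    *)
Definition root_linear (e : nat) (phi : {additive R -> R}) : Prop :=
  forall r y, phi (r ^+ (p ^ e) * y) = r * phi y.

(* a^[1/p^e]: the elements of the sum over all phi of the phi(a^(1/p^e)).      *)
Definition frobenius_root a (e : nat) : set R :=
  [set x | exists (n : nat) (phi : 'I_n -> {additive R -> R}) (y : 'I_n -> R),
     [/\ forall i, root_linear e (phi i), forall i, a (y i) &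
         x = \sum_(i < n) phi i (y i)]].

(* tau(a^(n/p^e)) *)
Definition test_ideal_frac a (n e : nat) : set R :=
  \bigcup_(f : nat) frobenius_root (ideal_exp a (n * p ^ f)) (e + f).

(* The ceiling is a natural number when 0 <= t; other t are not meaningful.    *)
Definition test_ideal (K : realType) a (t : K) : set R :=
  \bigcup_(e : nat) test_ideal_frac a `|Num.ceil (t * p%:R ^+ e)|%N e.

End TestIdeals.

Definition perfect_field (k : fieldType) : Prop :=
  forall q, q \in [pchar k] -> forall x : k, exists y, y ^+ q = x.

Definition finite_type (k : fieldType) (B : comAlgType k) : Prop :=
  exists s : seq B, forall A : {pred B},
    GRing.subalg_closed A -> {subset s <= A} -> forall b, b \in A.

(* The k-algebra structure on R is the one transported along f.                *)
Definition ess_finite_type (k : fieldType) (R : comPzRingType) : Prop :=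
  exists (B : comAlgType k) (W : mulrClosed B),
    finite_type B /\ exists f : {rmorphism localization W -> R}, bijective f.

(* Main.v *)
Require Import Defs.
From HB Require Import structures.
From mathcomp Require Import all_boot all_order all_algebra.
From mathcomp Require Import generic_quotient ring_quotient.
From mathcomp Require Import all_classical all_reals.
From mathcomp Require Import ring lra zify.

(* The heart of the matter is Kunz's theorem: R^(1/p) is a projective          *)
(* R-module, i.e. Frobenius has a dual basis, x = sum_i phi_i(x)^p g_i with    *)
(* p^-1-linear phi_i.  At a prime P, Krull's principal ideal theorem shows     *)
(* that d = dim R_P generators of P R_P form a regular sequence, hence so do   *)
(* their p-th powers; descending along that sequence with Nakayama's lemma, a  *)
(* minimal system of generators of R_P over its subring of p-th powers is      *)
(* free.  The scalars c for which multiplication by c on R^(1/p) factors       *)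
(* through a free module form an ideal contained in no prime, so 1 is one.     *)
(*                                                                             *)
(* By the dual basis, a^[1/q] is contained in an ideal J iff a is contained in *)
(* J^[q], the ideal generated by the q-th powers of J.  Subadditivity then     *)
(* comes from (J^[q])^n <= (J^n)^[q], and right continuity from the triviality *)
(* of tight closure, i.e. from Krull's intersection theorem.  For a ring       *)
(* morphism h : R -> S and a q^-1-linear psi on S, psi(h y) is the sum of the  *)
(* h(phi_i y) psi(h g_i); this gives restriction and half of localization.     *)

(** Write q = p^e. Everything rests on one adjunction: a^[1/q] is the least ideal J with a inside
    J^[q]. One half is formal ([frobenius_root_sub_power]); the other, [sub_frobenius_power_root],
    uses the dual basis supplied by [kunz]. Together with purity of Frobenius ([frobenius_pure]) it
    shows that the ideals (a^ceil(t q))^[1/q] increase with e, so in a noetherian ring the test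
    ideal is one of them ([test_ideal_stable]).

    Rounding in ceil(t q) is the obstacle for powers, integral closure and subadditivity. Right
    continuity removes it: tau(a^t) lies in tau(a^(t+eps)), and eps q eventually exceeds any
    constant, so a bounded loss in the exponent is absorbed ([test_ideal_perturb]). Powers follow at
    once, integral closure because the N-shifted powers of the closure lie in those of a
    ([integral_closure_exp]), and subadditivity from [frobenius_root_mul].

    The Briançon-Skoda theorem is a pigeonhole on monomials: in degree at least r q some q-th power
    of a generator splits off and passes through each p^-e-linear map ([skoda_level]). Localization
    and restriction transport such maps along a ring morphism ([frobenius_root_image],
    [root_linear_localize]). *)

Set Implicit Arguments.
Unset Strict Implicit.
Unset Printing Implicit Defensive.

Import Order.TTheory GRing.Theory Num.Theory.

Local Open Scope classical_set_scope.
Local Open Scope ring_scope.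

(** * Ideals *)

Section IdealTheory.
Variable R : comPzRingType.
Implicit Types (I J K A B : set R).

Section IdealClosure.
Variables (I : set R) (idI : is_ideal I).

Lemma idl0 : I 0. Proof. by case: idI. Qed.
Lemma idlD x y : I x -> I y -> I (x + y). Proof. by case: idI => _ + _; apply. Qed.
Lemma idlMl r x : I x -> I (r * x). Proof. by case: idI => _ _; apply. Qed.
Lemma idlMr r x : I x -> I (x * r). Proof. by rewrite mulrC; apply: idlMl. Qed.
Lemma idlN x : I x -> I (- x). Proof. by rewrite -mulN1r; apply: idlMl. Qed.
Lemma idlB x y : I x -> I y -> I (x - y).
Proof. by move=> Ix Iy; apply: idlD => //; apply: idlN. Qed.
Lemma idlBl x y : I x -> I (x - y) -> I y.
Proof. by move=> Ix Ixy; rewrite -[y](subKr x); apply: idlB. Qed.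
Lemma idlBr x y : I y -> I (x - y) -> I x.
Proof. by move=> Iy Ixy; rewrite -[x](subrK y); apply: idlD. Qed.
Lemma idl_sum (T : Type) (s : seq T) (Q : pred T) (F : T -> R) :
  (forall i, Q i -> I (F i)) -> I (\sum_(i <- s | Q i) F i).
Proof. by move=> IF; elim/big_ind : _ => //; [exact: idl0 | exact: idlD]. Qed.

End IdealClosure.

Lemma ideal_setT : is_ideal [set: R]. Proof. by []. Qed.

Lemma zero_ideal : is_ideal [set 0 : R].
Proof. by split=> [|x y -> ->|r x ->] //=; rewrite ?addr0 ?mulr0. Qed.

Lemma sum_split (n m : nat) (F : 'I_n -> R) (G : 'I_m -> R) :
  \sum_(i < n + m) match fintype.split i with inl j => F j | inr j => G j end =
  \sum_(i < n) F i + \sum_(i < m) G i.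
Proof.
rewrite big_split_ord /=; congr (_ + _); apply: eq_bigr => i _.
  by rewrite (unsplitK (inl _ i)).
by rewrite (unsplitK (inr _ i)).
Qed.

Lemma ideal_gen_ideal A : is_ideal (ideal_gen A).
Proof.
split.
- by exists 0%N, (fun=> 0), (fun=> 0); split=> [[]//|]; rewrite big_ord0.
- move=> x y [n [r [g [Ag ->]]]] [m [r' [g' [Ag' ->]]]].
  exists (n + m)%N, (fun i => match fintype.split i with inl j => r j | inr j => r' j end).
  exists (fun i => match fintype.split i with inl j => g j | inr j => g' j end).
  split=> [i|]; first by case: fintype.split.
  by rewrite -sum_split; apply: eq_bigr => i _; case: fintype.split.
- move=> a x [n [r [g [Ag ->]]]]; exists n, (fun i => a * r i), g; split=> //.
  by rewrite mulr_sumr; apply: eq_bigr => i _; rewrite mulrA.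
Qed.

Lemma sub_ideal_gen A : A `<=` ideal_gen A.
Proof.
move=> x Ax; exists 1%N, (fun=> 1), (fun=> x); split=> //.
by rewrite big_ord1 mul1r.
Qed.

Lemma ideal_gen_sub A I : is_ideal I -> A `<=` I -> ideal_gen A `<=` I.
Proof.
move=> idI AI _ [n [r [g [Ag ->]]]]; apply: idl_sum => // i _.
by apply: idlMl => //; apply: AI.
Qed.

Lemma ideal_gen_mono A B : A `<=` B -> ideal_gen A `<=` ideal_gen B.
Proof.
by move=> AB; apply: ideal_gen_sub; [exact: ideal_gen_ideal|];
  apply: subset_trans AB _; apply: sub_ideal_gen.
Qed.

Definition setprod A B : set R := [set x | exists i j, [/\ A i, B j & x = i * j]].

Lemma ideal_mulE A J : is_ideal J -> ideal_mul A J = ideal_gen (setprod A J).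
Proof.
move=> idJ; apply/seteqP; split=> [_ [n [f [g [Af Jg ->]]]]|_ [n [r [g [Ag ->]]]]].
  apply: idl_sum => [|i _]; first exact: ideal_gen_ideal.
  by apply: sub_ideal_gen; exists (f i), (g i).
have /choice[h hP] : forall i, exists h : R * R, [/\ A h.1, J h.2 & g i = h.1 * h.2].
  by move=> i; have [u [v ?]] := Ag i; exists (u, v).
exists n, (fun i => (h i).1), (fun i => r i * (h i).2); split=> [i|i|].
- by case: (hP i).
- by apply: idlMl => //; case: (hP i).
- by apply: eq_bigr => i _; case: (hP i) => _ _ ->; rewrite mulrCA.
Qed.

Lemma ideal_mul_ideal A J : is_ideal J -> is_ideal (ideal_mul A J).
Proof. by move=> idJ; rewrite ideal_mulE //; apply: ideal_gen_ideal. Qed.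

Lemma mem_ideal_mul A B x y : A x -> B y -> ideal_mul A B (x * y).
Proof.
by move=> Ax By; exists 1%N, (fun=> x), (fun=> y); split=> //; rewrite big_ord1.
Qed.

Lemma ideal_mul_sub A B I : is_ideal I ->
  (forall x y, A x -> B y -> I (x * y)) -> ideal_mul A B `<=` I.
Proof.
by move=> idI ABI _ [n [f [g [Af Bg ->]]]]; apply: idl_sum => // i _; apply: ABI.
Qed.

Lemma ideal_mul_mono A A' B B' :
  A `<=` A' -> B `<=` B' -> ideal_mul A B `<=` ideal_mul A' B'.
Proof.
move=> AA' BB' _ [n [f [g [Af Bg ->]]]]; exists n, f, g.
by split=> // i; [exact: AA'|exact: BB'].
Qed.

Lemma ideal_exp_ideal A n : is_ideal (ideal_exp A n).
Proof. by case: n => [|n]; [exact: ideal_setT | elim: n => [|n IH]; exact: ideal_mul_ideal]. Qed.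

Lemma ideal_expS A n : ideal_exp A n.+1 = ideal_mul A (ideal_exp A n).
Proof. by []. Qed.

Lemma mem_ideal_expS A n x y :
  A x -> ideal_exp A n y -> ideal_exp A n.+1 (x * y).
Proof. by rewrite ideal_expS; apply: mem_ideal_mul. Qed.

Lemma ideal_exp_mono A B n : A `<=` B -> ideal_exp A n `<=` ideal_exp B n.
Proof. by move=> AB; elim: n => // n IH; apply: ideal_mul_mono. Qed.

Lemma ideal_exp_le A m n : (m <= n)%N -> ideal_exp A n `<=` ideal_exp A m.
Proof.
elim: n m => [|n IH] [|m] // le_mn.
by apply: ideal_mul_mono => //; apply: IH.
Qed.

Lemma ideal_exp1 I : is_ideal I -> ideal_exp I 1 = I.
Proof.
move=> idI; apply/seteqP; split=> [|x Ix].
  by apply: ideal_mul_sub => // x y Ix _; apply: idlMr.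
by rewrite -[x]mulr1; apply: mem_ideal_mul.
Qed.

Lemma ideal_exp_sub I n : is_ideal I -> (0 < n)%N -> ideal_exp I n `<=` I.
Proof. by move=> idI n0; rewrite -{2}(ideal_exp1 idI); apply: ideal_exp_le. Qed.

Lemma mem_ideal_expD A m n x y :
  ideal_exp A m x -> ideal_exp A n y -> ideal_exp A (m + n) (x * y).
Proof.
elim: m x => [|m IH] x Ax Ay; first by apply: idlMl => //; apply: ideal_exp_ideal.
move: Ax; rewrite ideal_expS => -[k [f [g [Af Ag ->]]]]; rewrite mulr_suml.
apply: (idl_sum (ideal_exp_ideal A _)) => i _.
by rewrite -mulrA addSn; apply: mem_ideal_expS => //; apply: IH.
Qed.

Lemma ideal_mul_expD A m n :
  ideal_mul (ideal_exp A m) (ideal_exp A n) = ideal_exp A (m + n).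
Proof.
apply/seteqP; split.
  by apply: ideal_mul_sub; [exact: ideal_exp_ideal | move=> x y; exact: mem_ideal_expD].
elim: m => [|m IH] x Ax; first by rewrite -[x]mul1r; apply: mem_ideal_mul.
move: Ax; rewrite ideal_expS => -[k [f [g [Af Ag ->]]]].
apply: idl_sum => [|i _]; first exact/ideal_mul_ideal/ideal_exp_ideal.
have [k' [u [v [Au Av ->]]]] := IH _ (Ag i); rewrite mulr_sumr.
apply: idl_sum => [|j _]; first exact/ideal_mul_ideal/ideal_exp_ideal.
by rewrite mulrA; apply: mem_ideal_mul => //; apply: mem_ideal_expS.
Qed.

Lemma mem_ideal_expX A n m x : ideal_exp A n x -> ideal_exp A (n * m) (x ^+ m).
Proof.
by move=> Ax; elim: m => [|m IH]; rewrite ?muln0 // mulnS exprS; apply: mem_ideal_expD.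
Qed.

Lemma mem_ideal_exp_pow A m x : A x -> ideal_exp A m (x ^+ m).
Proof. by move=> Ax; elim: m => [|m IH] //; rewrite exprS; apply: mem_ideal_expS. Qed.

Lemma ideal_exp_exp A n m : ideal_exp (ideal_exp A n) m = ideal_exp A (n * m).
Proof.
by elim: m => [|m IH]; [rewrite muln0 | rewrite mulnS ideal_expS IH ideal_mul_expD].
Qed.

(** The iteration defining [ideal_exp] starts from the unit ideal, so powers of a mere set are
    already ideals, and coefficients of generators can be pushed into the last factor. *)
Lemma ideal_exp_gen A n : ideal_exp (ideal_gen A) n = ideal_exp A n.
Proof.
apply/seteqP; split; last by apply: ideal_exp_mono; apply: sub_ideal_gen.
elim: n => // n IH; apply: ideal_mul_sub; first exact: ideal_exp_ideal.
move=> _ y [k [r [g [Ag ->]]]] /IH Ay; rewrite mulr_suml.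
apply: (idl_sum (ideal_exp_ideal A _)) => i _.
by rewrite -mulrA mulrCA ideal_expS; apply: mem_ideal_mul => //; apply: idlMl => //; apply: ideal_exp_ideal.
Qed.

(** * Monomials in finitely many generators, written as words *)

Section FiniteGeneration.
Variables (r : nat) (g : 'I_r -> R).

Lemma ideal_exp_words N : ideal_exp (range g) N =
  ideal_gen [set x | exists2 w : seq 'I_r, size w = N & x = \prod_(i <- w) g i].
Proof.
apply/seteqP; split.
  elim: N => [|N IH].
    move=> x _; rewrite -[x]mulr1; apply: idlMl; first exact: ideal_gen_ideal.
    by apply: sub_ideal_gen; exists [::]; rewrite ?big_nil.
  apply: ideal_mul_sub; first exact: ideal_gen_ideal.
  move=> _ _ [i _ <-] /IH[k [a [h [hP ->]]]]; rewrite mulr_sumr.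
  apply: idl_sum => [|j _]; first exact: ideal_gen_ideal.
  rewrite mulrCA; apply: idlMl; first exact: ideal_gen_ideal.
  have [w sw ->] := hP j; apply: sub_ideal_gen.
  by exists (i :: w); rewrite ?big_cons //= sw.
apply: ideal_gen_sub; first exact: ideal_exp_ideal.
move=> _ [w <- ->]; elim: w => [|i w IH]; first by [].
by rewrite big_cons; apply: mem_ideal_mul => //; exists i.
Qed.

(** If each letter i occurred fewer than [c i] times, the length would be at most the sum of the
    [c i - 1]. This one count serves nilpotence of a radical, integral closure and the
    Briançon-Skoda theorem. *)
Lemma word_pigeonhole (c : 'I_r -> nat) (w : seq 'I_r) :
  (forall i, 0 < c i)%N -> (\sum_i (c i).-1 < size w)%N ->
  exists i w', size w = (c i + size w')%N /\
    \prod_(j <- w) g j = g i ^+ c i * \prod_(j <- w') g j.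
Proof.
move=> c0 small.
have [i ci] : exists i, (c i <= count_mem i w)%N.
  apply: contrapT => /forallNP noti; move: small; rewrite ltnNge => /negP; apply.
  have -> : size w = (\sum_i count_mem i w)%N.
    elim: w {noti} => [|j w IH] /=; first by rewrite big1.
    rewrite big_split /= -IH (bigD1 j) //= eqxx big1 // => k /negbTE.
    by rewrite eq_sym => ->.
  apply: leq_sum => i _; rewrite -ltnS prednK // ltnNge.
  by apply/negP => /noti.
exists i, (nseq (count_mem i w - c i) i ++ seq.filter (predC1 i) w).
have e : perm_eq w (nseq (c i) i ++ (nseq (count_mem i w - c i) i ++
    seq.filter (predC1 i) w)).
  rewrite catA -nseqD subnKC // -(perm_filterC (pred1 i)) perm_cat2r.
  have /all_pred1P -> : all (pred1 i) (seq.filter (pred1 i) w) by exact: seq.filter_all.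
  by rewrite size_filter.
split; first by rewrite (perm_size e) !size_cat !size_nseq.
by rewrite (perm_big _ e) big_cat /= big_nseq iter_mulr_1.
Qed.

End FiniteGeneration.

End IdealTheory.

(** * Noetherian rings *)

Section Noetherian.
Variables (R : comPzRingType) (nR : noetherian R).
Implicit Types (I J K L M P Q A B : set R).

Lemma noeth_chain (J : nat -> set R) :
  (forall n, is_ideal (J n)) -> (forall n, J n `<=` J n.+1) ->
  exists N, forall n, (N <= n)%N -> J n = J N.
Proof.
move=> idJ incJ.
have leJ m n : (m <= n)%N -> J m `<=` J n.
  move=> /subnK <-; elim: (n - m)%N => // k IH.
  by apply: subset_trans IH _; rewrite addSn; apply: incJ.
have idU : is_ideal (\bigcup_n J n).
  split=> [|x y [m _ Jx] [n _ Jy]|r x [n _ Jx]].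
  - by exists 0%N => //; apply: idl0.
  - exists (maxn m n) => //; apply: idlD => //.
      by apply: leJ Jx; apply: leq_maxl.
    by apply: leJ Jy; apply: leq_maxr.
  - by exists n => //; apply: idlMl.
have [r [g gE]] := nR idU.
have /choice[k kP] : forall i, exists k, J k (g i).
  move=> i; have : (\bigcup_n J n) (g i) by rewrite gE; apply: sub_ideal_gen; exists i.
  by case=> k _ Jk; exists k.
exists (\max_i k i) => n le_n; apply/seteqP; split; last exact: leJ.
move=> x Jx; have : (\bigcup_n J n) x by exists n.
rewrite gE; apply: ideal_gen_sub => // _ [i _ <-].
by apply: leJ (kP i); apply: leq_bigmax.
Qed.

(** Without a maximal member, a choice of strictly larger members, iterated from I, would contradict
    [noeth_chain]. *)
Lemma noeth_max (Q : set R -> Prop) I : is_ideal I -> Q I ->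
  exists M, [/\ is_ideal M, Q M &
    forall J, is_ideal J -> Q J -> M `<=` J -> J `<=` M].
Proof.
move=> idI QI; apply: contrapT => noM.
have /choice[h hP] : forall M, exists J, is_ideal M -> Q M ->
    [/\ is_ideal J, Q J, M `<=` J & ~ J `<=` M].
  move=> M; apply: contrapT => /forallNP noJ; apply: noM; exists M.
  have [idM QM] : is_ideal M /\ Q M.
    by apply: contrapT => nM; apply: (noJ M) => idM QM; case: nM.
  by split=> // J idJ QJ MJ; apply: contrapT => JM; apply: (noJ J).
pose f n := iter n h I.
have fP n : is_ideal (f n) /\ Q (f n).
  by elim: n => // n [idf Qf]; have [] := hP _ idf Qf.
have [|n|N fN] := @noeth_chain f; first by move=> n; case: (fP n).
  by have [idf Qf] := fP n; have [] := hP _ idf Qf.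
have [idf Qf] := fP N; have [_ _ _] := hP _ idf Qf; apply.
by rewrite -[h _]/(f N.+1) fN.
Qed.

Definition adjoin I (a : R) : set R := [set y | exists r, I (y - r * a)].

Lemma adjoin_ideal I a : is_ideal I -> is_ideal (adjoin I a).
Proof.
move=> idI; split.
- by exists 0; rewrite mul0r subr0; apply: idl0.
- move=> x y [r Ix] [s Iy]; exists (r + s).
  have -> : x + y - (r + s) * a = (x - r * a) + (y - s * a) by ring.
  exact: idlD.
- move=> s x [r Ix]; exists (s * r).
  by rewrite -mulrA -mulrBr; apply: idlMl.
Qed.

Lemma sub_adjoin I a : I `<=` adjoin I a.
Proof. by move=> x Ix; exists 0; rewrite mul0r subr0. Qed.

Lemma mem_adjoin I a : is_ideal I -> adjoin I a a.
Proof. by move=> idI; exists 1; rewrite mul1r subrr; apply: idl0. Qed.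

Lemma adjoin_sub I J a : is_ideal J -> I `<=` J -> J a -> adjoin I a `<=` J.
Proof.
move=> idJ IJ Ja x [r Ix]; apply: (idlBr idJ (y := r * a)); last exact: IJ.
exact: idlMl.
Qed.

(** An ideal M maximal among those containing I and missing U is prime: if x and y are outside M,
    both M + (x) and M + (y) meet U, and the product of the two common elements lies in U and in M +
    (xy). *)
Lemma prime_avoiding I (U : set R) : is_ideal I ->
  U 1 -> (forall x y, U x -> U y -> U (x * y)) -> (forall x, I x -> ~ U x) ->
  exists P, [/\ prime_ideal P, I `<=` P & forall x, P x -> ~ U x].
Proof.
move=> idI U1 UM IU.
have [|M [idM [IM MU] maxM]] :=
  @noeth_max (fun J => I `<=` J /\ forall x, J x -> ~ U x) I idI; first by split.
exists M; split=> //; split=> // [M1|x y Mxy]; first exact: MU M1 U1.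
apply: contrapT => /not_orP[Mx My].
have meet z : ~ M z -> exists2 u, U u & adjoin M z u.
  move=> Mz; apply: contrapT => noU; apply: Mz.
  apply: (maxM (adjoin M z)) (mem_adjoin _ _) => //.
  - exact: adjoin_ideal.
  - split; first exact: subset_trans IM (@sub_adjoin _ _).
    by move=> u Mu Uu; apply: noU; exists u.
  - exact: sub_adjoin.
have [u Uu [r Mu]] := meet x Mx; have [v Uv [s Mv]] := meet y My.
apply: (MU (u * v)); last exact: UM.
have -> : u * v = u * (v - s * y) + s * y * (u - r * x) + r * s * (x * y) by ring.
by do ![apply: idlD => //]; apply: idlMl.
Qed.

Lemma prime_above I : is_ideal I -> ~ I 1 -> exists2 P, prime_ideal P & I `<=` P.
Proof.
move=> idI I1; have [|x y -> ->|x Ix x1|P [? ? _]] := @prime_avoiding I [set 1] idI.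
- by [].
- by rewrite /= mul1r.
- by apply: I1; rewrite -x1.
- by exists P.
Qed.

Lemma radical_power I M : is_ideal I -> is_ideal M ->
  (forall x, I x -> exists k, M (x ^+ k)) -> exists N, ideal_exp I N `<=` M.
Proof.
move=> idI idM radM; have [r [g gE]] := nR idI.
have /choice[c cP] : forall i, exists c, M (g i ^+ c).
  by move=> i; apply: radM; rewrite gE; apply: sub_ideal_gen; exists i.
exists (\sum_i c i).+1; rewrite gE ideal_exp_gen ideal_exp_words.
apply: ideal_gen_sub => // _ [w sw ->].
have [//||i [w' [_ ->]]] := @word_pigeonhole _ _ g (fun i => (c i).+1) w.
  by rewrite sw /= ltnS.
by rewrite exprS mulrAC; apply: (idlMl idM).
Qed.

(* Herstein's argument: an ideal M that is maximal subject to M meeting Rx in  *)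
(* Ix contains a power of I.                                                   *)
Theorem krull_intersection I x : is_ideal I ->
  (forall n, ideal_exp I n x) -> exists2 i, I i & x = i * x.
Proof.
move=> idI Ix; pose Q M := (forall i, I i -> M (i * x)) /\
  forall r, M (r * x) -> exists2 i, I i & r * x = i * x.
have idIx : is_ideal [set y | exists2 i, I i & y = i * x].
  split=> [|_ _ [i Ii ->] [j Ij ->]|r _ [i Ii ->]].
  - by exists 0; rewrite ?mul0r //; apply: idl0.
  - by exists (i + j); rewrite ?mulrDl //; apply: idlD.
  - by exists (r * i); rewrite ?mulrA //; apply: idlMl.
have [|M [idM [IM MI] maxM]] := @noeth_max Q _ idIx.
  by split=> // i Ii; exists i.
have [a Ia|N IN] := @radical_power I M idI idM.
(* The colon ideals (M : a^k) become stationary at some k. For r x = c a^k modulo M, multiplying by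
   a lands in Ix, hence in M, so c lies in (M : a^(k+1)) = (M : a^k) and r x is in M. Thus M + (a^k)
   still satisfies Q, and a^k is in M by maximality. *)
- pose C k := [set c | M (c * a ^+ k)].
  have idC k : is_ideal (C k).
    split=> [|c d|r c]; rewrite /C /=.
    - by rewrite mul0r; apply: idl0.
    - by rewrite mulrDl; apply: idlD.
    - by rewrite -mulrA; apply: idlMl.
  have incC k : C k `<=` C k.+1.
    by move=> c; rewrite /C /= exprS mulrCA; apply: idlMl.
  have [k Ck] := noeth_chain idC incC; exists k.
  apply: (maxM (adjoin M (a ^+ k))) (mem_adjoin _ _) => //.
  + exact: adjoin_ideal.
  + split=> [i Ii|r [c Mc]]; first exact/sub_adjoin/IM.
    apply: MI; apply: (idlBr idM (y := c * a ^+ k)) => //.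
    have : C k.+1 c; last by rewrite (Ck k.+1).
    rewrite /C /= exprS mulrCA.
    apply: (idlBl idM (x := (a * r) * x)); last first.
      by rewrite -mulrA -mulrBr; apply: idlMl.
    by apply: IM; apply: idlMr.
  + exact: sub_adjoin.
by have := MI 1; rewrite mul1r; apply; apply: IN.
Qed.

End Noetherian.

(** * Krull's principal ideal theorem *)

Section PrimeFacts.
Variables (R : comPzRingType) (P : set R) (prP : prime_ideal P).

Lemma prime_is_ideal : is_ideal P. Proof. by case: prP. Qed.
Lemma prime1 : ~ P 1. Proof. by case: prP. Qed.
Lemma primeM x y : P (x * y) -> P x \/ P y. Proof. by case: prP => _ _; apply. Qed.
Lemma primeNM x y : ~ P x -> ~ P y -> ~ P (x * y).
Proof. by move=> Px Py /primeM[]. Qed.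
Lemma primeX x n : P (x ^+ n) -> P x.
Proof. by elim: n => [|n IH]; [move=> /prime1 | rewrite exprS => /primeM[]]. Qed.
Lemma primeNX x n : ~ P x -> ~ P (x ^+ n). Proof. by move=> Px /primeX. Qed.
Lemma primeNB s x : ~ P s -> P x -> ~ P (s - x).
Proof. by move=> Ps Px Psx; apply: Ps; apply: (idlBr prime_is_ideal Px). Qed.
Lemma primeN_prod (T : Type) (r : seq T) (F : T -> R) :
  (forall i, ~ P (F i)) -> ~ P (\prod_(i <- r) F i).
Proof. by move=> PF; elim/big_ind: _ => //; [exact: prime1 | exact: primeNM]. Qed.

End PrimeFacts.

(* [saturated P I] says that I is the contraction of an ideal of the           *)
(* localization R_P; working with such ideals replaces computing in R_P.       *)
Section Saturation.
Variables (R : comPzRingType) (P : set R) (prP : prime_ideal P).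
Implicit Types (I J K L : set R).

Definition saturated I := forall s y, ~ P s -> I (s * y) -> I y.

Definition satur I : set R := [set y | exists2 s, ~ P s & I (s * y)].

Lemma satur_ideal I : is_ideal I -> is_ideal (satur I).
Proof.
move=> idI; split=> [|x y [s Ps Ix] [t Pt Iy]|r x [s Ps Ix]].
- by exists 1; [exact: prime1 | rewrite mulr0; apply: idl0].
- exists (s * t); first exact: primeNM.
  have -> : s * t * (x + y) = t * (s * x) + s * (t * y) by ring.
  by apply: idlD => //; apply: idlMl.
- by exists s => //; rewrite mulrCA; apply: idlMl.
Qed.

Lemma saturated_satur I : saturated (satur I).
Proof.
move=> s y Ps [t Pt]; rewrite mulrA => It; exists (t * s) => //.
exact: primeNM.
Qed.

Lemma sub_satur I : I `<=` satur I.
Proof. by move=> x Ix; exists 1; [exact: prime1 | rewrite mul1r]. Qed.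

Lemma satur_sub I J : saturated J -> I `<=` J -> satur I `<=` J.
Proof. by move=> satJ IJ x [s Ps /IJ]; apply: satJ. Qed.

Lemma satur_mono I J : I `<=` J -> satur I `<=` satur J.
Proof. by move=> IJ x [s Ps /IJ]; exists s. Qed.

Lemma prime_saturated Q : prime_ideal Q -> Q `<=` P -> saturated Q.
Proof. by move=> prQ QP s y Ps /(primeM prQ)[/QP|]. Qed.

Definition sadd I a : set R := satur (adjoin I a).

Lemma saddP I a y : sadd I a y <-> exists s r, ~ P s /\ I (s * y - r * a).
Proof. by split=> [[s Ps [r Ir]]|[s [r [Ps Ir]]]]; exists s => //; exists r. Qed.

Lemma sadd_ideal I a : is_ideal I -> is_ideal (sadd I a).
Proof. by move=> idI; apply/satur_ideal/adjoin_ideal. Qed.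

Lemma saturated_sadd I a : saturated (sadd I a).
Proof. exact: saturated_satur. Qed.

Lemma sub_sadd I a : I `<=` sadd I a.
Proof. exact: subset_trans (@sub_adjoin _ _ a) (@sub_satur _). Qed.

Lemma mem_sadd I a : is_ideal I -> sadd I a a.
Proof. by move=> idI; apply/sub_satur/mem_adjoin. Qed.

Lemma sadd_sub I J a : is_ideal J -> saturated J -> I `<=` J -> J a ->
  sadd I a `<=` J.
Proof. by move=> idJ satJ IJ Ja; apply: satur_sub => //; apply: adjoin_sub. Qed.

Hypothesis nR : noetherian R.

(** Noetherian induction replaces the determinant trick. Take M maximal among saturated ideals that
    contain L but not K, and k in K outside M. Locally K lies in M + (k), so PK lies in M + Pk, and
    the hypothesis yields (t s - q) k in M with q in P; the factor is a local unit. *)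
Theorem nakayama K L : is_ideal K -> is_ideal L -> saturated L ->
  (forall y, K y -> exists s z, [/\ ~ P s, ideal_mul P K z & L (s * y - z)]) ->
  K `<=` L.
Proof.
move=> idK idL satL KPK; apply: contrapT => KL.
have [|M [idM [satM LM MK] maxM]] :=
  @noeth_max _ nR (fun M => [/\ saturated M, L `<=` M & ~ K `<=` M]) L idL; first by split.
have [k Kk Mk] : exists2 k, K k & ~ M k.
  by apply: contrapT => noK; apply: MK => k Kk; apply: contrapT => Mk; apply: noK; exists k.
have Kadd : K `<=` sadd M k.
  apply: contrapT => nK; apply: Mk; apply: (maxM (sadd M k)).
  - exact: sadd_ideal.
  - split=> //; first exact: saturated_sadd.
    exact: subset_trans LM (@sub_sadd _ _).
  - exact: sub_sadd.
  - exact: mem_sadd.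
have PKadd z : ideal_mul P K z -> exists t q, [/\ ~ P t, P q & M (t * z - q * k)].
  have idZ : is_ideal [set z | exists t q, [/\ ~ P t, P q & M (t * z - q * k)]].
    have idP := prime_is_ideal prP; split.
    - exists 1, 0; split; [exact: prime1|exact: idl0|].
      by rewrite mulr0 mul0r subrr; apply: idl0.
    - move=> x y [t [q [Pt Pq Mx]]] [t' [q' [Pt' Pq' My]]].
      exists (t * t'), (t' * q + t * q'); split; first exact: primeNM.
        by apply: idlD => //; apply: idlMl.
      have -> : t * t' * (x + y) - (t' * q + t * q') * k =
        t' * (t * x - q * k) + t * (t' * y - q' * k) by ring.
      by apply: idlD => //; apply: idlMl.
    - move=> r x [t [q [Pt Pq Mx]]]; exists t, (r * q); split=> //.
        exact: idlMl.
      have -> : t * (r * x) - r * q * k = r * (t * x - q * k) by ring.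
      exact: idlMl.
  move=> PKz; apply: (ideal_mul_sub idZ _ PKz) => x y Px Ky.
  have /saddP[s [r [Ps Mr]]] := Kadd _ Ky.
  exists s, (x * r); split=> //; first exact: (idlMr (prime_is_ideal prP)).
  have -> : s * (x * y) - x * r * k = x * (s * y - r * k) by ring.
  exact: idlMl.
have [s [z [Ps PKz Lz]]] := KPK _ Kk.
have [t [q [Pt Pq Mz]]] := PKadd _ PKz.
apply: Mk; apply: (satM (t * s - q)).
  by apply: primeNB => //; apply: primeNM.
have -> : (t * s - q) * k = t * (s * k - z) + (t * z - q * k) by ring.
by apply: idlD => //; apply: idlMl => //; apply: LM.
Qed.

Corollary nakayama1 K L x : P x -> is_ideal K -> is_ideal L -> saturated L ->
  (forall y, K y -> exists s r, [/\ ~ P s, K r & L (s * y - r * x)]) ->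
  K `<=` L.
Proof.
move=> Px idK idL satL Kx; apply: nakayama => // y /Kx[s [r [Ps Kr Ly]]].
by exists s, (r * x); split=> //; rewrite mulrC; apply: mem_ideal_mul.
Qed.

End Saturation.

Section PrincipalIdealTheorem.
Variables (R : comPzRingType) (nR : noetherian R).
Implicit Types (A B I J P Q : set R).

(* The descending chain condition in the ring R_P / A R_P.                     *)
Definition artinian_at P A := forall J : nat -> set R,
  (forall n, [/\ is_ideal (J n), saturated P (J n), A `<=` J n & J n.+1 `<=` J n]) ->
  exists N, forall n, (N <= n)%N -> J n `<=` J n.+1.

(** A maximal counterexample M has a socle element z outside it, with P z inside M, and M + (z) is
    artinian. A chain over M either always contains z, or eventually excludes it; then stability of
    J n + (z) gives that of J n, since a multiple r z in J n forces r into P and so r z into M. *)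
Lemma artinian_at_power P A N : prime_ideal P ->
  is_ideal A -> saturated P A -> ideal_exp P N `<=` A -> artinian_at P A.
Proof.
move=> prP idA satA PA; apply: contrapT => nA.
have [|M [idM [satM AM nM] maxM]] := @noeth_max _ nR
  (fun B => [/\ saturated P B, A `<=` B & ~ artinian_at P B]) A idA; first by split.
have [j Pj PSj] : exists2 j, ~ ideal_exp P j `<=` M & ideal_exp P j.+1 `<=` M.
  apply: contrapT => noj; suff : ~ ideal_exp P N `<=` M.
    by apply; apply: subset_trans AM.
  elim: N {PA} => [|j IH]; last by move=> PSj; apply: noj; exists j.
  move=> TM; apply: nM => J JP; exists 0%N => n _ x _.
  by have [_ _ MJ _] := JP n.+1; apply: MJ; apply: TM.
have [z Pz Mz] : exists2 z, ideal_exp P j z & ~ M z.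
  by apply: contrapT => noz; apply: Pj => z Pz; apply: contrapT => Mz; apply: noz; exists z.
have PzM r : P r -> M (r * z) by move=> Pr; apply: PSj; apply: mem_ideal_expS.
have goodB : artinian_at P (sadd P M z).
  apply: contrapT => nB; apply: Mz; apply: (maxM (sadd P M z)).
  - exact: sadd_ideal.
  - split=> //; first exact: saturated_sadd.
    by apply: subset_trans AM _; apply: sub_sadd.
  - exact: sub_sadd.
  - exact: mem_sadd.
apply: nM => J JP.
have decJ m n : (m <= n)%N -> J n `<=` J m.
  move=> /subnK <-; elim: (n - m)%N => // k IH.
  by apply: subset_trans IH; rewrite addSn; case: (JP (k + m)%N).
have [allz|/existsNP[n1 Jz]] := pselect (forall n, J n z).
  apply: goodB => n; have [idJ satJ MJ dJ] := JP n; split=> //.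
  exact: sadd_sub.
have [n|n2 n2P] := goodB (fun n => sadd P (J n) z).
  have [idJ satJ MJ dJ] := JP n; split.
  - exact: sadd_ideal.
  - exact: saturated_sadd.
  - apply: sadd_sub; [exact: sadd_ideal|exact: saturated_sadd| |exact: mem_sadd].
    by apply: subset_trans MJ _; apply: sub_sadd.
  - apply: sadd_sub; [exact: sadd_ideal|exact: saturated_sadd| |exact: mem_sadd].
    by apply: subset_trans dJ _; apply: sub_sadd.
exists (maxn n1 n2) => n; rewrite geq_max => /andP[n1n n2n] y Jy.
have [idJ satJ _ dJ] := JP n; have [idJS satJS MJS _] := JP n.+1.
have /saddP[s [r [Ps Jr]]] := n2P _ n2n _ (@sub_sadd _ _ prP _ z _ Jy).
have Jrz : J n (r * z).
  by apply: (idlBl idJ (x := s * y)); [exact: idlMl | exact: dJ].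
have Pr : P r.
  apply: contrapT => Pr; apply: Jz; apply: decJ n1n _ _.
  exact: satJ Pr Jrz.
apply: (satJS _ _ Ps); apply: (idlBr idJS (y := r * z)) => //.
exact/MJS/PzM.
Qed.

(* Krull's principal ideal theorem: otherwise P2 is minimal over P0 + (x), so  *)
(* R_P2 / (P0 + (x)) is artinian, the symbolic powers K n of P1 modulo P0      *)
(* become stationary, and P1 is nilpotent modulo P0.                           *)
Theorem prime_between P0 P1 P2 x :
  prime_ideal P0 -> prime_ideal P1 -> prime_ideal P2 ->
  P0 `<` P1 -> P1 `<` P2 -> P2 x ->
  exists Q, [/\ prime_ideal Q, P0 `<` Q, Q `<` P2 & Q x].
Proof.
move=> pr0 pr1 pr2 lt01 lt12 P2x; apply: contrapT => noQ.
have P1x : ~ P1 x by move=> P1x; apply: noQ; exists P1.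
have [[le01 nle10] [le12 nle21]] := (lt01, lt12).
have id0 := prime_is_ideal pr0; have id1 := prime_is_ideal pr1.
have id2 := prime_is_ideal pr2.
have P0x : ~ P0 x by move/le01.
pose A := sadd P2 P0 x.
have idA : is_ideal A by apply: sadd_ideal.
have satA : saturated P2 A by apply: saturated_sadd.
have radA y : P2 y -> exists k, A (y ^+ k).
  move=> P2y; apply: contrapT => nA.
  (* A prime containing A and missing U lies in P2 and misses y, while it contains P0 and x: it
     would be the intermediate prime excluded by [noQ]. *)
  pose U := [set u | exists s k, ~ P2 s /\ u = s * y ^+ k].
  have [| | |Q [prQ AQ QU]] := @prime_avoiding _ nR A U idA.
  - by exists 1, 0%N; rewrite mul1r; split=> //; apply: prime1.
  - move=> _ _ [s [k [Ps ->]]] [t [l [Pt ->]]]; exists (s * t), (k + l)%N.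
    by split; [exact: primeNM | rewrite exprD mulrACA].
  - by move=> u Au [s [k [Ps uE]]]; apply: nA; exists k; apply: (satA s) => //; rewrite -uE.
  have QP : Q `<=` P2.
    move=> s Qs; apply: contrapT => Ps; apply: (QU _ Qs).
    by exists s, 0%N; rewrite mulr1.
  have Qx : Q x by apply: AQ; apply: mem_sadd.
  apply: noQ; exists Q; split=> //; split=> //.
  - by apply: subset_trans AQ; apply: sub_sadd.
  - by move/(_ _ Qx).
  - move/(_ _ P2y) => Qy; apply: (QU _ Qy); exists 1, 1%N.
    by rewrite mul1r; split=> //; apply: prime1.
have [N PN] := radical_power nR id2 idA radA.
have artA := artinian_at_power pr2 idA satA PN.
pose S n := [set y | exists u v, [/\ P0 u, ideal_exp P1 n v & y = u + v]].
pose K n := satur P1 (S n).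
have idS n : is_ideal (S n).
  have idE := ideal_exp_ideal P1 n; split.
  - by exists 0, 0; rewrite addr0; split=> //; apply: idl0.
  - move=> _ _ [u [v [Pu Pv ->]]] [u' [v' [Pu' Pv' ->]]].
    by exists (u + u'), (v + v'); rewrite addrACA; split=> //; apply: idlD.
  - move=> r _ [u [v [Pu Pv ->]]]; exists (r * u), (r * v).
    by rewrite mulrDr; split=> //; apply: idlMl.
have idK n : is_ideal (K n) by apply: satur_ideal.
have satK n : saturated P1 (K n) by apply: saturated_satur.
have sat2K n : saturated P2 (K n).
  by move=> s y Ps; apply: satK => /le12.
have decK n : K n.+1 `<=` K n.
  apply: satur_mono => _ [u [v [Pu Pv ->]]]; exists u, v; split=> //.
  by move: Pv; apply: ideal_exp_le.
have [n|n nP] := artA (fun n => sadd P2 (K n) x).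
  split; [exact: sadd_ideal|exact: saturated_sadd| |].
  - apply: sadd_sub; [exact: sadd_ideal|exact: saturated_sadd| |exact: mem_sadd].
    move=> u Pu; apply: sub_sadd => //; apply: sub_satur => //.
    by exists u, 0; rewrite addr0; split=> //; apply: (idl0 (ideal_exp_ideal P1 n)).
  - apply: sadd_sub; [exact: sadd_ideal|exact: saturated_sadd| |exact: mem_sadd].
    by apply: subset_trans (decK n) _; apply: sub_sadd.
(* From s y = r x modulo K (n+1), r x is in K n, so r is too, because x is outside P1 and K n is
   saturated at P1. Nakayama's lemma at P2 applies. *)
have KS : K n `<=` K n.+1.
  apply: (nakayama1 pr2 nR P2x) => // y Ky.
  have /saddP[s [r [Ps Kr]]] := nP _ (leqnn n) _ (@sub_sadd _ _ pr2 _ x _ Ky).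
  exists s, r; split=> //; apply: (satK _ x) => //; rewrite mulrC.
  by apply: (idlBl (idK n) (x := s * y)); [exact: idlMl | exact: decK].
have P1n : ideal_exp P1 n `<=` P0.
  apply: (nakayama pr1 nR) => //; first exact: ideal_exp_ideal.
    exact: prime_saturated.
  move=> y Py; have [|s Ps [u [v [Pu Pv e]]]] := KS y.
    apply: sub_satur => //; exists 0, y; rewrite add0r; split=> //; exact: idl0.
  by exists s, v; split=> //; rewrite e addrK.
apply: nle10 => y Py; apply: (primeX pr0 (n := n)); apply: P1n.
by have := @mem_ideal_expX _ P1 1 n y; rewrite mul1n ideal_exp1 //; apply.
Qed.

End PrincipalIdealTheorem.

(** * Regular local rings *)

Section RegularSequences.
Variables (R : comPzRingType) (P : set R) (prP : prime_ideal P).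
Implicit Types (I J A C : set R) (s : seq R).

Definition sadds I s : set R := foldl (sadd P) I s.

Lemma sadds_ideal I s : is_ideal I -> is_ideal (sadds I s).
Proof. by elim: s I => //= a s IH I idI; apply/IH/sadd_ideal. Qed.

Lemma saturated_sadds I s : saturated P I -> saturated P (sadds I s).
Proof. by elim: s I => //= a s IH I satI; apply/IH/saturated_sadd. Qed.

Lemma sub_sadds I s : I `<=` sadds I s.
Proof.
elim: s I => [|a s IH] I //=; apply: subset_trans (IH _); exact: sub_sadd.
Qed.

Lemma mem_sadds I s a : is_ideal I -> a \in s -> sadds I s a.
Proof.
elim: s I => //= b s IH I idI; rewrite inE => /predU1P[->|sa].
  by apply: sub_sadds; apply: mem_sadd.
by apply: IH => //; apply: sadd_ideal.
Qed.

Lemma sadds_sub I J s : is_ideal J -> saturated P J -> I `<=` J ->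
  (forall a, a \in s -> J a) -> sadds I s `<=` J.
Proof.
move=> idJ satJ; elim: s I => //= a s IH I IJ sJ; apply: IH => [|b sb].
  by apply: sadd_sub => //; apply: sJ; rewrite mem_head.
by apply: sJ; rewrite inE sb orbT.
Qed.

Definition regular_mod I a := forall y, I (a * y) -> I y.

Fixpoint regular_seq I s :=
  if s is a :: s' then regular_mod I a /\ regular_seq (sadd P I a) s' else True.

Lemma saddC I a b : is_ideal I -> saturated P I ->
  sadd P (sadd P I a) b `<=` sadd P (sadd P I b) a.
Proof.
move=> idI satI; have ida c : is_ideal (sadd P I c) by apply: sadd_ideal.
have idb : is_ideal (sadd P (sadd P I b) a) by apply: sadd_ideal.
have satb : saturated P (sadd P (sadd P I b) a) by apply: saturated_sadd.
apply: sadd_sub => //; last by apply: sub_sadd => //; apply: mem_sadd.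
apply: sadd_sub => //; last exact: mem_sadd.
by apply: subset_trans (@sub_sadd _ _ prP _ b) (@sub_sadd _ _ prP _ a).
Qed.

(** From s a y = w z modulo I, regularity of z modulo a makes a local multiple of w divisible by a;
    then a cancels. *)
Lemma regular_swap I a z : is_ideal I -> regular_mod I a ->
  regular_mod (sadd P I a) z -> regular_mod (sadd P I z) a.
Proof.
move=> idI rega regz y /saddP[s [w [Ps Iw]]].
have /regz/saddP[t [w' [Pt Iw']]] : sadd P I a (z * w).
  apply/saddP; exists 1, (s * y); split; first exact: prime1.
  have -> : 1 * (z * w) - s * y * a = - (s * (a * y) - w * z) by ring.
  exact: idlN.
apply/saddP; exists (t * s), w'; split; first exact: primeNM.
apply: rega.
have -> : a * (t * s * y - w' * z) =
  t * (s * (a * y) - w * z) + z * (t * w - w' * a) by ring.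
by apply: idlD => //; apply: idlMl.
Qed.

Lemma regular_mod_pow I a z n : is_ideal I -> regular_mod I a ->
  regular_mod (sadd P I a) z -> regular_mod (sadd P I (a ^+ n.+1)) z.
Proof.
move=> idI rega regz; elim: n => // n IH y /saddP[s [r [Ps Ir]]].
have /regz/saddP[t [y' [Pt Iy']]] : sadd P I a (z * y).
  by apply/saddP; exists s, (r * a ^+ n.+1); rewrite -mulrA -exprSr.
have /IH/saddP[u [v [Pu Iv]]] : sadd P I (a ^+ n.+1) (z * y').
  apply/saddP; exists s, (t * r); split=> //; apply: rega.
  have -> : a * (s * (z * y') - t * r * a ^+ n.+1) =
    t * (s * (z * y) - r * a ^+ n.+2) - s * z * (t * y - y' * a).
    by rewrite [a ^+ n.+2]exprS; ring.
  by apply: idlB => //; apply: idlMl.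
apply/saddP; exists (u * t), v; split; first exact: primeNM.
have -> : u * t * y - v * a ^+ n.+2 = u * (t * y - y' * a) + a * (u * y' - v * a ^+ n.+1).
  by rewrite [a ^+ n.+2]exprS; ring.
by apply: idlD => //; apply: idlMl.
Qed.

Lemma regular_seq_mono I J s : I `<=` J -> J `<=` I -> regular_seq I s -> regular_seq J s.
Proof. by move=> IJ JI; have -> : I = J by apply/seteqP. Qed.

(** The next element z is handled by [regular_mod_pow]; after swapping, a is regular modulo (I, z),
    so induction applies there. *)
Lemma regular_seq_head_pow I a s n : is_ideal I -> saturated P I -> regular_mod I a ->
  regular_seq (sadd P I a) s -> regular_seq (sadd P I (a ^+ n.+1)) s.
Proof.
elim: s I => // z s IH I idI satI rega [regz regs]; split.
  exact: regular_mod_pow.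
apply: (@regular_seq_mono (sadd P (sadd P I z) (a ^+ n.+1))); try exact: saddC.
apply: IH; [exact: sadd_ideal|exact: saturated_sadd|exact: regular_swap|].
by apply: regular_seq_mono regs; exact: saddC.
Qed.

Lemma regular_seq_pow I s n : is_ideal I -> saturated P I ->
  regular_seq I s -> regular_seq I [seq a ^+ n.+1 | a <- s].
Proof.
elim: s I => // a s IH I idI satI [rega regs]; split.
  by elim: (n) => [|m IHm] y; rewrite ?expr1 ?[a ^+ m.+2]exprS -?mulrA => /rega // /IHm.
apply: IH; [exact: sadd_ideal|exact: saturated_sadd|].
exact: regular_seq_head_pow.
Qed.

(** A chain of n strict inclusions of primes starting at A and ending inside P, built from the
    bottom so that it can be rerouted through a given element. *)
Fixpoint prime_tower n A : Prop :=
  if n is n'.+1 then exists C, [/\ prime_ideal C, A `<` C & prime_tower n' C]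
  else A `<=` P.

Lemma prime_tower_sub n A : prime_tower n A -> A `<=` P.
Proof.
elim: n A => [|n IH] A //= [C [_ [leAC _] /IH CP]]; exact: subset_trans leAC CP.
Qed.

Hypothesis nR : noetherian R.

(** The element x of P is brought down the chain one prime at a time by [prime_between], without
    changing the length. *)
Lemma prime_tower_through n A x : prime_ideal A -> P x -> prime_tower n.+1 A ->
  exists C, [/\ prime_ideal C, A `<` C, C x & prime_tower n C].
Proof.
move=> + Px; elim: n A => [|n IH] A prA [C [prC [leAC CA] tC]].
  exists P; split=> //; split; first exact: subset_trans leAC tC.
  by apply: contra_not CA; apply: subset_trans.
have [C' [prC' CC' C'x tC']] := IH _ prC tC.
have [Q [prQ AQ QC' Qx]] := prime_between nR prA prC prC' (conj leAC CA) CC' C'x.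
by exists Q; split=> //; exists C'.
Qed.

(** Krull's height theorem at P: each generator uses up one step of a rerouted chain. *)
Lemma prime_tower_height n I A s : is_ideal I -> prime_ideal A -> I `<=` A ->
  P `<=` sadds I s -> (forall a, a \in s -> P a) -> prime_tower n A ->
  (n <= size s)%N.
Proof.
elim: s n I A => [|a s IH] [|n] I A idI prA IA PI sP //= tA.
  case: tA => C [_ [_ CA] /prime_tower_sub CP]; case: CA.
  by apply: subset_trans CP _; apply: subset_trans PI _.
have Pa : P a by apply: sP; rewrite mem_head.
have [C [prC [leAC _] Ca tC]] := prime_tower_through prA Pa tA.
apply: (IH _ (sadd P I a) C) => //; first exact: sadd_ideal.
  apply: sadd_sub => //; [exact: prime_is_ideal| |exact: subset_trans IA leAC].
  by apply: (prime_saturated prC); apply: prime_tower_sub tC.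
by move=> b sb; apply: sP; rewrite inE sb orbT.
Qed.

(** A regular local ring is a domain and its parameters form a regular sequence. Rerouting the chain
    through a gives a prime C over (I, a), which induction identifies with (I, a). As a is not in A,
    elements of A are locally a times elements of A modulo I, so A = I by Nakayama's lemma. *)
Theorem prime_tower_regular I A s : is_ideal I -> saturated P I ->
  prime_ideal A -> I `<=` A -> P `<=` sadds I s -> (forall a, a \in s -> P a) ->
  prime_tower (size s) A -> A `<=` I /\ regular_seq I s.
Proof.
elim: s I A => [|a s IH] I A idI satI prA IA PI sP tA.
  by split=> //; apply: subset_trans tA PI.
have Pa : P a by apply: sP; rewrite mem_head.
have sP' b : b \in s -> P b by move=> sb; apply: sP; rewrite inE sb orbT.
have idA := prime_is_ideal prA.
have satA : saturated P A by apply: (prime_saturated prA); apply: prime_tower_sub tA.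
have [C [prC [leAC CA] Ca tC]] := prime_tower_through prA Pa tA.
have IaC : sadd P I a `<=` C.
  apply: sadd_sub => //; [exact: prime_is_ideal| |exact: subset_trans IA leAC].
  by apply: (prime_saturated prC); apply: prime_tower_sub tC.
have [CI regs] : C `<=` sadd P I a /\ regular_seq (sadd P I a) s.
  by apply: IH => //; [exact: sadd_ideal|exact: saturated_sadd].
have Aa : ~ A a.
  (* If a were in A, the [size s] elements of s would generate P over (I, a), contained in A, below
     a chain of length [size s + 1]. *)
  move=> Aa; suff : (size (a :: s) <= size s)%N by rewrite ltnn.
  apply: (@prime_tower_height _ (sadd P I a) A) => //; first exact: sadd_ideal.
  exact: sadd_sub.
have AI : A `<=` I.
  apply: (nakayama1 prP nR Pa) => // y Ay.
  have /saddP[t [r [Pt Ir]]] := CI _ (leAC _ Ay).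
  exists t, r; split=> //; have : A (r * a).
    by apply: (idlBl idA (x := t * y)); [exact: idlMl|exact: IA].
  by case/(primeM prA).
by split=> //; split=> // y /IA/(primeM prA)[//|/AI].
Qed.

End RegularSequences.

Section LocalizationFacts.
Variables (R : comPzRingType) (W : mulrClosed R).
Local Notation loc := (tolocal W).

Lemma tolocal_cancel w (x y : localization W) :
  w \in W -> loc w * x = loc w * y -> x = y.
Proof.
move=> /tolocal_unit[v vE] e'.
have vw z : v * (loc w * z) = z by rewrite mulrA [v * _]mulrC vE mul1r.
by rewrite -[x]vw e' vw.
Qed.

Lemma tolocal_eqP x y : loc x = loc y <-> exists2 w, w \in W & w * x = w * y.
Proof.
split=> [e'|[w Ww e']]; last by apply: (tolocal_cancel Ww); rewrite -!rmorphM e'.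
have /tolocal_eq0[w Ww e''] : loc (x - y) = 0 by rewrite rmorphB /= e' subrr.
by exists w => //; apply/eqP; rewrite -subr_eq0 -mulrBr e''.
Qed.

End LocalizationFacts.

Section RegularLocalization.
Variables (R : comPzRingType) (P : set R) (prP : prime_ideal P).
Local Notation W := (prime_compl prP).
Local Notation L := (localization W).
Local Notation loc := (tolocal W).
Implicit Types (J : set R).

Lemma prime_complP w : w \in W <-> ~ P w.
Proof. by rewrite -notin_setE. Qed.

Definition extension J : set L :=
  [set z | exists r w, [/\ ~ P w, J r & loc w * z = loc r]].

Lemma extension_ideal J : is_ideal J -> is_ideal (extension J).
Proof.
move=> idJ; split.
- exists 0, 1; split; [exact: prime1|exact: idl0|by rewrite mulr0 rmorph0].
- move=> x y [r [w [Pw Jr e]]] [r' [w' [Pw' Jr' e']]].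
  exists (w' * r + w * r'), (w * w'); split; first exact: primeNM.
    by apply: idlD => //; apply: idlMl.
  rewrite rmorphD !rmorphM /=; move: (loc r) (loc r') e e' => _ _ <- <-; ring.
- move=> z x [r [w [Pw Jr e]]]; have [b [v [/prime_complP Pv e']]] := tolocal_surj z.
  exists (b * r), (v * w); split; [exact: primeNM|exact: idlMl|].
  rewrite !rmorphM /=; move: (loc r) (loc b) e e' => _ _ <- <-; ring.
Qed.

Lemma mem_extension J x : is_ideal J -> saturated P J -> extension J (loc x) -> J x.
Proof.
move=> idJ satJ [r [w [Pw Jr]]]; rewrite -rmorphM => /tolocal_eqP[u /prime_complP Pu e].
by apply: (satJ w) => //; apply: (satJ u) => //; rewrite e; apply: idlMl.
Qed.

Lemma ideal_unit (J : set L) w z : is_ideal J -> ~ P w -> J (loc w * z) -> J z.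
Proof.
move=> idJ /prime_complP/tolocal_unit[v e] Jz.
have -> : z = v * (loc w * z) by rewrite mulrA [v * _]mulrC [loc w * v]e mul1r.
exact: idlMl.
Qed.

Lemma extension_maximal : maximal_ideal (extension P).
Proof.
have idP := prime_is_ideal prP; split; first exact: extension_ideal.
  by move=> e1; apply: (prime1 prP); apply: mem_extension => //; exact: prime_saturated.
move=> J idJ J1 PJ; apply/seteqP; split=> // z Jz.
have [r [w [/prime_complP Pw e]]] := tolocal_surj z.
exists r, w; split=> //; apply: contrapT => Pr; apply: J1.
by apply: (ideal_unit idJ Pr); rewrite mulr1 -e; apply: idlMl.
Qed.

Lemma contraction_prime (Q : set L) : prime_ideal Q -> prime_ideal (loc @^-1` Q).
Proof.
move=> prQ; have idQ := prime_is_ideal prQ; split=> [|/=|x y /=].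
- split=> [|x y|r x] /=; rewrite ?rmorph0 ?rmorphD ?rmorphM.
  + exact: idl0.
  + exact: idlD.
  + exact: idlMl.
- by rewrite rmorph1; apply: prime1.
- by rewrite rmorphM; apply: primeM.
Qed.

Lemma contraction_sub (Q : set L) : prime_ideal Q -> loc @^-1` Q `<=` P.
Proof.
move=> prQ x Qx; apply: contrapT => Px; apply: (prime1 prQ).
by apply: (ideal_unit (prime_is_ideal prQ) Px); rewrite mulr1.
Qed.

Lemma contraction_tower n (Q : nat -> set L) :
  prime_chain n Q -> prime_tower P n (loc @^-1` Q 0%N).
Proof.
elim: n Q => [|n IH] Q [prQ ltQ] /=; first by apply: contraction_sub; apply: prQ.
exists (loc @^-1` Q 1%N); split.
- by apply: contraction_prime; apply: prQ.
- have [le01 nle10] := ltQ 0%N isT; split=> [x|le10]; first exact: le01.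
  apply: nle10 => z Qz; have [r [w [/prime_complP Pw e]]] := tolocal_surj z.
  have pr0 : prime_ideal (Q 0%N) by apply: prQ.
  apply: (ideal_unit (prime_is_ideal pr0) Pw); rewrite [loc w * z]e.
  apply: le10; rewrite /= -e; apply: idlMl => //.
  by apply: prime_is_ideal; apply: prQ.
- by apply: (IH (fun i => Q i.+1)); split=> i; [apply: (prQ i.+1) | apply: (ltQ i.+1)].
Qed.

(** Regularity of R_P restated inside R: numerators of d generators of the maximal ideal, and the
    contraction of a chain of d + 1 primes. [satur P [set 0]] is the kernel of R -> R_P. *)
Lemma regular_local_tower : regular_local L -> exists s A,
  [/\ forall a, a \in s -> P a, P `<=` sadds P (satur P [set 0]) s,
      prime_ideal A & prime_tower P (size s) A].
Proof.
move=> [_ [m [d [_ /(_ _ extension_maximal) <- [[Q chQ] _] [g mE]]]]].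
have /choice[a aP] : forall i, exists a, exists w, [/\ ~ P w, P a & loc w * g i = loc a].
  move=> i; have : extension P (g i) by rewrite mE; apply: sub_ideal_gen; exists i.
  by case=> r [w ?]; exists r, w.
have prA : prime_ideal (loc @^-1` Q 0%N).
  by apply: contraction_prime; case: chQ => prQ _; apply: prQ.
exists [seq a i | i <- enum 'I_d], (loc @^-1` Q 0%N); split=> //.
- by move=> _ /mapP[i _ ->]; have [w []] := aP i.
- have idT : is_ideal (satur P [set 0]) by apply/satur_ideal/zero_ideal.
  set J := sadds _ _ _; have idJ : is_ideal J by apply: sadds_ideal.
  have satJ : saturated P J by apply/saturated_sadds/saturated_satur.
  move=> x Px; apply: mem_extension => //.
  have : extension P (loc x).
    by exists x, 1; split=> //; [exact: prime1 | rewrite rmorph1 mul1r].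
  rewrite mE; apply: ideal_gen_sub; first exact: extension_ideal.
  move=> _ [i _ <-]; have [w [Pw Pa e]] := aP i; exists (a i), w; split=> //.
  by apply: mem_sadds => //; apply: map_f; rewrite mem_enum.
- by rewrite size_map size_enum_ord; apply: contraction_tower.
Qed.

End RegularLocalization.

(** * Kunz's theorem *)

Lemma common_denominator (R : comPzRingType) (P : set R) (prP : prime_ideal P)
    (T : finType) (Q : T -> R -> Prop) :
  (forall i s t, Q i s -> Q i (t * s)) -> (forall i, exists2 s, ~ P s & Q i s) ->
  exists2 s, ~ P s & forall i, Q i s.
Proof.
move=> QM Qs; have /choice[s sP] : forall i, exists s, ~ P s /\ Q i s.
  by move=> i; have [s] := Qs i; exists s.
exists (\prod_i s i) => [|i]; first by apply: primeN_prod => // i; case: (sP i).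
by rewrite (bigD1 i) //= mulrC; apply: QM; case: (sP i).
Qed.

Section FrobeniusPower.
Variables (R : comNzRingType) (p : nat) (charR : p \in [pchar R]).

Lemma frobD e (x y : R) : (x + y) ^+ (p ^ e) = x ^+ (p ^ e) + y ^+ (p ^ e).
Proof.
elim: e x y => [|e IH] x y; first by rewrite !expr1.
by rewrite expnSr !exprM IH -!(pFrobenius_autE charR) rmorphD.
Qed.

Lemma frobN e (x : R) : (- x) ^+ (p ^ e) = - x ^+ (p ^ e).
Proof.
apply/eqP; rewrite -addr_eq0 -frobD addNr expr0n expn_eq0.
by rewrite eqn0Ngt prime_gt0 // (pcharf_prime charR).
Qed.

Lemma frobB e (x y : R) : (x - y) ^+ (p ^ e) = x ^+ (p ^ e) - y ^+ (p ^ e).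
Proof. by rewrite frobD frobN. Qed.

Lemma frob0 e : 0 ^+ (p ^ e) = 0 :> R.
Proof. by rewrite -(subrr 0) frobB !subrr. Qed.

Lemma frob_sum e (T : Type) (r : seq T) (Q : pred T) (F : T -> R) :
  (\sum_(i <- r | Q i) F i) ^+ (p ^ e) = \sum_(i <- r | Q i) F i ^+ (p ^ e).
Proof. by elim/big_rec2: _ => [|i x y _ <-]; rewrite ?frob0 ?frobD. Qed.

Lemma frobp_sum (T : Type) (r : seq T) (Q : pred T) (F : T -> R) :
  (\sum_(i <- r | Q i) F i) ^+ p = \sum_(i <- r | Q i) F i ^+ p.
Proof. by have := frob_sum 1 r Q F; rewrite expn1. Qed.

Lemma frobpB (x y : R) : (x - y) ^+ p = x ^+ p - y ^+ p.
Proof. by have := frobB 1 x y; rewrite expn1. Qed.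

Lemma frobpD (x y : R) : (x + y) ^+ p = x ^+ p + y ^+ p.
Proof. by have := frobD 1 x y; rewrite expn1. Qed.

Lemma pchar_predK : p = p.-1.+1.
Proof. by rewrite prednK // prime_gt0 // (pcharf_prime charR). Qed.

End FrobeniusPower.

Section LocalBasis.
Variables (R : comNzRingType) (p : nat) (charR : p \in [pchar R]).
Variables (P : set R) (prP : prime_ideal P).
Implicit Types (I J : set R).

Definition locally_generates n (g : 'I_n -> R) := forall x, exists s (c : 'I_n -> R),
  ~ P s /\ s ^+ p * x = \sum_i c i ^+ p * g i.

(* The contraction of P^[p] R_P: at P, P^[p] consists of the combinations of g *)
(* with coefficients c_i ^+ p, c_i in P.                                       *)
Definition frob_fiber n (g : 'I_n -> R) : set R :=
  [set y | exists t (c : 'I_n -> R),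
    [/\ ~ P t, forall i, P (c i) & t ^+ p * y = \sum_i c i ^+ p * g i]].

Section Generators.
Variables (n : nat) (g : 'I_n -> R) (gen : locally_generates g).

Lemma locally_generates_common (T : finType) (f : T -> R) :
  exists s (c : T -> 'I_n -> R),
    ~ P s /\ forall i, s ^+ p * f i = \sum_j c i j ^+ p * g j.
Proof.
have [|i|s Ps sP] := @common_denominator _ P prP T
    (fun i s => exists c : 'I_n -> R, s ^+ p * f i = \sum_j c j ^+ p * g j).
- move=> i s t [c e]; exists (fun j => t * c j).
  rewrite exprMn -mulrA e mulr_sumr; apply: eq_bigr => j _.
  by rewrite exprMn mulrA.
- by have [s [c [Ps e]]] := gen (f i); exists s => //; exists c.
by have [c cP] := choice sP; exists s, c.
Qed.

Lemma frob_fiber_ideal : is_ideal (frob_fiber g).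
Proof.
have idP := prime_is_ideal prP; split.
- exists 1, (fun=> 0); split=> [|i|]; [exact: prime1|exact: idl0|].
  rewrite mulr0 big1 // => i _.
  by rewrite (pchar_predK charR) exprS !mul0r.
- move=> x y [t [c [Pt Pc e]]] [t' [c' [Pt' Pc' e']]].
  exists (t * t'), (fun i => t' * c i + t * c' i); split=> [|i|].
  + exact: primeNM.
  + by apply: idlD => //; apply: idlMl.
  + have -> : (t * t') ^+ p * (x + y) = t' ^+ p * (t ^+ p * x) + t ^+ p * (t' ^+ p * y).
      by rewrite exprMn; ring.
    rewrite e e' !mulr_sumr -big_split; apply: eq_bigr => i _ /=.
    by rewrite (frobpD charR) !exprMn; ring.
- move=> r x [t [c [Pt Pc e]]].
  have [s [d [Ps de]]] := locally_generates_common (fun i => r * g i).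
  exists (s * t), (fun j => \sum_i c i * d i j); split=> [|j|].
  + exact: primeNM.
  + by apply: idl_sum => // i _; apply: idlMr.
  + have -> : (s * t) ^+ p * (r * x) = s ^+ p * r * (t ^+ p * x).
      by rewrite exprMn; ring.
    rewrite e mulr_sumr.
    under eq_bigr => i _.
      have -> : s ^+ p * r * (c i ^+ p * g i) = c i ^+ p * (s ^+ p * (r * g i)) by ring.
      rewrite de mulr_sumr; over.
    rewrite exchange_big; apply: eq_bigr => j _ /=.
    rewrite (frobp_sum charR) mulr_suml; apply: eq_bigr => i _.
    by rewrite exprMn mulrA.
Qed.

Lemma saturated_frob_fiber : saturated P (frob_fiber g).
Proof.
move=> s y Ps Zsy.
have [t [c [Pt Pc e]]] := idlMl frob_fiber_ideal (s ^+ p.-1) Zsy.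
exists (t * s), c; split=> //; first exact: primeNM.
rewrite -e exprMn {2}(pchar_predK charR) exprS; ring.
Qed.

Lemma frob_fiber_pow a : P a -> frob_fiber g (a ^+ p).
Proof.
move=> Pa; have [t [c [Pt e]]] := gen 1.
exists t, (fun i => a * c i); split=> // [i|].
  by apply: (idlMr (prime_is_ideal prP)).
have -> : t ^+ p * a ^+ p = a ^+ p * (t ^+ p * 1) by ring.
rewrite e mulr_sumr; apply: eq_bigr => i _.
by rewrite exprMn mulrA.
Qed.

Hypothesis min_n : forall m (h : 'I_m -> R), locally_generates h -> (n <= m)%N.

(** If some c_k were outside P, the difference of the two expressions would have the local unit u^p
    as coefficient of g_k, and g_k could be eliminated, against the minimality of n. *)
Lemma minimal_generators_fiber (c : 'I_n -> R) :
  frob_fiber g (\sum_i c i ^+ p * g i) -> forall i, P (c i).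
Proof.
move=> [t [d [Pt Pd e]]] k; apply: contrapT => Pck.
case: n g gen min_n c d k e Pd Pck => [|m] h genh minm c d k e Pd Pck; first by case: k {Pck}.
pose u := t * c k - d k.
have Pu : ~ P u by apply: primeNB => //; apply: primeNM.
have hk : u ^+ p * h k = \sum_i (d (lift k i) - t * c (lift k i)) ^+ p * h (lift k i).
  have : \sum_i (t * c i - d i) ^+ p * h i = 0.
    under eq_bigr => i _ do rewrite (frobpB charR) mulrBl exprMn -mulrA.
    by rewrite sumrB -mulr_sumr e subrr.
  rewrite (bigD1_ord k) //= => /eqP; rewrite addr_eq0 => /eqP ->.
  rewrite -sumrN; apply: eq_bigr => i _.
  by rewrite !(frobpB charR) -mulNr opprB.
suff : (m < m)%N by rewrite ltnn.
apply: (minm m (fun i => h (lift k i))) => x.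
have [s [b [Ps xE]]] := genh x.
exists (u * s), (fun i => b k * (d (lift k i) - t * c (lift k i)) + u * b (lift k i)).
split; first exact: primeNM.
rewrite exprMn -mulrA xE (bigD1_ord k) //= mulrDr mulrCA hk !mulr_sumr -big_split /=.
apply: eq_bigr => i _.
by move: (d _ - _) (u) => v w; rewrite (frobpD charR) !exprMn; ring.
Qed.

Hypothesis nR : noetherian R.

(* J stands for I^[p].  The descent from (I, a) to I is Nakayama's lemma for   *)
(* the ideal of the k-th coefficients of the relations modulo J: it equals a   *)
(* times itself modulo I, since a^p is regular modulo J.                       *)
Lemma frobenius_independent (s : seq R) I J :
  is_ideal I -> saturated P I -> is_ideal J ->
  (forall y, I y -> J (y ^+ p)) ->
  regular_seq P J [seq a ^+ p | a <- s] -> (forall a, a \in s -> P a) ->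
  (forall c : 'I_n -> R, sadds P J [seq a ^+ p | a <- s] (\sum_i c i ^+ p * g i) ->
     forall i, sadds P I s (c i)) ->
  forall c : 'I_n -> R, J (\sum_i c i ^+ p * g i) -> forall i, I (c i).
Proof.
elim: s I J => [|a s IH] I J idI satI idJ IJ /=; first by [].
move=> [rega regs] sP top.
have Pa : P a by apply: sP; rewrite mem_head.
have IHa : forall c : 'I_n -> R, sadd P J (a ^+ p) (\sum_i c i ^+ p * g i) ->
    forall i, sadd P I a (c i).
  apply: IH => //; first exact: sadd_ideal; first exact: saturated_sadd.
  - exact: sadd_ideal.
  - move=> y /saddP[t [r [Pt /IJ]]]; rewrite (frobpB charR) !exprMn => Jt.
    by apply/saddP; exists (t ^+ p), (r ^+ p); split=> //; apply: primeNX.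
  - by move=> b sb; apply: sP; rewrite inE sb orbT.
move=> c0 Jc0 k.
pose K := [set y | exists c : 'I_n -> R, c k = y /\ J (\sum_i c i ^+ p * g i)].
suff KI : K `<=` I by apply: KI; exists c0.
have idK : is_ideal K.
  split.
  - exists (fun=> 0); split=> //; rewrite big1 => [|i _]; first exact: idl0.
    by rewrite (pchar_predK charR) exprS !mul0r.
  - move=> _ _ [c [<- Jc]] [d [<- Jd]]; exists (fun i => c i + d i); split=> //.
    under eq_bigr do rewrite (frobpD charR) mulrDl.
    by rewrite big_split /=; apply: idlD.
  - move=> r _ [c [<- Jc]]; exists (fun i => r * c i); split=> //.
    under eq_bigr do rewrite exprMn -mulrA.
    by rewrite -mulr_sumr; apply: idlMl.
apply: (nakayama1 prP nR Pa) => // _ [c [<- Jc]].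
have [|i|t Pt] := @common_denominator _ P prP _ (fun i t => exists v, I (t * c i - v * a)).
- move=> i t u [v Iv]; exists (u * v).
  have -> : u * t * c i - u * v * a = u * (t * c i - v * a) by ring.
  exact: idlMl.
- have /saddP[t [v [Pt Iv]]] := IHa c (@sub_sadd _ _ prP _ (a ^+ p) _ Jc) i.
  by exists t => //; exists v.
move=> /choice[v Iv]; exists t, (v k); split=> //; exists v; split=> //.
apply: rega; apply: (idlBl idJ (x := t ^+ p * \sum_i c i ^+ p * g i)).
  exact: idlMl.
rewrite !mulr_sumr -sumrB; apply: idl_sum => // i _.
have -> : t ^+ p * (c i ^+ p * g i) - a ^+ p * (v i ^+ p * g i) =
  g i * (t * c i - v i * a) ^+ p by rewrite (frobpB charR) !exprMn; ring.
by apply: idlMl => //; apply: IJ.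
Qed.

End Generators.

Hypotheses (nR : noetherian R) (FR : F_finite p R).
Hypothesis regP : regular_local (localization (prime_compl prP)).

Theorem frobenius_local_basis : exists n (g : 'I_n -> R), locally_generates g /\
  forall c : 'I_n -> R, \sum_i c i ^+ p * g i = 0 -> forall i, satur P [set 0] (c i).
Proof.
have exn : exists n, `[< exists g : 'I_n -> R, locally_generates g >].
  have [n [g gP]] := FR; exists n; apply/asboolP; exists g => x.
  have [c ->] := gP x; exists 1, c; rewrite expr1n mul1r; split=> //; exact: prime1.
case: (ex_minnP exn) => n /asboolP[g gen] minn; exists n, g; split=> //.
have min_n m (h : 'I_m -> R) : locally_generates h -> (n <= m)%N.
  by move=> genh; apply: minn; apply/asboolP; exists h.
have [s [A [sP PS prA tA]]] := regular_local_tower regP.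
set T := satur P [set 0] in PS *.
have idT : is_ideal T by apply/satur_ideal/zero_ideal.
have satT : saturated P T by apply: saturated_satur.
have TA : T `<=` A.
  apply: satur_sub => [|_ ->]; last exact: (idl0 (prime_is_ideal prA)).
  by apply: (prime_saturated prA); apply: prime_tower_sub tA.
have [_ regs] := prime_tower_regular prP nR idT satT prA TA PS sP tA.
(* The kernel T of R -> R_P plays both I and J. At the top of the descent, (T, s^p) lies in the
   fiber ideal, so minimality puts the coefficients in P, which is contained in (T, s). *)
move=> c c0; apply: (@frobenius_independent n g nR s T T) => //.
- by move=> y Ty; rewrite (pchar_predK charR) exprS; apply: (idlMr idT).
- by rewrite (pchar_predK charR); apply: regular_seq_pow.
- move=> {c0}c Tc i; apply: PS; apply: (minimal_generators_fiber gen min_n (c := c)).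
  have idZ := frob_fiber_ideal gen; have satZ := saturated_frob_fiber gen.
  move: Tc; apply: sadds_sub => // [|_ /mapP[a sa ->]].
    by apply: satur_sub => // _ ->; apply: idl0.
  by apply: frob_fiber_pow => //; apply: sP.
- by rewrite c0; apply: idl0.
Qed.

End LocalBasis.

Lemma additive_of (U V : zmodType) (f : U -> V) : zmod_morphism f ->
  exists g : {additive U -> V}, forall x, g x = f x.
Proof.
move=> fB; pose m := GRing.isZmodMorphism.Build U V f fB.
by exists (HB.pack f m : {additive U -> V}).
Qed.

Lemma root_linear_mull (p : nat) (R : comPzRingType) e c (phi : {additive R -> R}) : root_linear p e phi ->
  exists psi : {additive R -> R}, root_linear p e psi /\ forall x, psi x = c * phi x.
Proof.
move=> lphi; have [|psi psiE] := @additive_of _ _ (fun x => c * phi x).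
  by move=> x y /=; rewrite raddfB mulrBr.
by exists psi; split=> // r y; rewrite !psiE lphi mulrCA.
Qed.

Section DualBasis.
Variables (p : nat) (R : comNzRingType) (charR : p \in [pchar R]).

(* For c = 1: R^(1/p^e) is a finitely generated projective R-module.           *)
Definition scaled_dual_basis e (c : R) := exists (T : finType)
    (phi : T -> {additive R -> R}) (g : T -> R),
  (forall i, root_linear p e (phi i)) /\
  forall x, c ^+ (p ^ e) * x = \sum_i phi i x ^+ (p ^ e) * g i.

Lemma scaled_dual_basis_ideal e : is_ideal (scaled_dual_basis e).
Proof.
split.
- exists void, (fun v : void => match v with end), (fun v : void => match v with end).
  by split=> [[]|x]; rewrite big1 ?(frob0 charR) ?mul0r // => -[].
- move=> c d [T [phi [g [lphi phiE]]]] [T' [phi' [g' [lphi' phiE']]]].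
  exists (T + T')%type, (fun i => match i with inl j => phi j | inr j => phi' j end).
  exists (fun i => match i with inl j => g j | inr j => g' j end).
  split=> [[]//|x].
  by rewrite (frobD charR) mulrDl phiE phiE' big_sumType.
- move=> c d [T [phi [g [lphi phiE]]]].
  have /choice[psi psiP] : forall i, exists psi : {additive R -> R},
      root_linear p e psi /\ forall x, psi x = c * phi i x.
    by move=> i; apply: root_linear_mull.
  exists T, psi, g; split=> [i|x]; first by case: (psiP i).
  rewrite exprMn -mulrA phiE mulr_sumr; apply: eq_bigr => i _.
  by case: (psiP i) => _ ->; rewrite exprMn mulrA.
Qed.

Hypotheses (nR : noetherian R) (FR : F_finite p R).

(** Denominators are cleared from the free basis at P. The coordinates are computed through global
    generators h over the p-th powers: x = sum b_j^p h_j and s^p h_j = sum c_ji^p g_i suggest sum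
    b_j c_ji as i-th coordinate of s^p x. *)
Lemma local_dual_basis (P : set R) (prP : prime_ideal P) :
  regular_local (localization (prime_compl prP)) ->
  exists2 c, ~ P c & scaled_dual_basis 1 c.
Proof.
move=> regP; have [n [g [gen indep]]] := frobenius_local_basis charR nR FR regP.
have [N [h hP]] := FR.
have [s [c [Ps sE]]] := locally_generates_common prP gen h.
set T := satur P [set 0] in indep.
have idT : is_ideal T by apply/satur_ideal/zero_ideal.
have [k [tau TE]] := nR idT.
have [|i|s' Ps' s'E] := @common_denominator _ P prP _ (fun i s' => s' * tau i = 0).
- by move=> i u t e; rewrite -mulrA e mulr0.
- have : T (tau i) by rewrite TE; apply: sub_ideal_gen; exists i.
  by case=> u; exists u.
have s'T z : T z -> s' * z = 0.
  rewrite TE => -[m [r [t [tT ->]]]]; rewrite mulr_sumr big1 // => i _.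
  by have [j _ <-] := tT i; rewrite mulrCA s'E mulr0.
(* The coefficients b are chosen, hence not additive in x. Two choices differ by a relation among
   the h_j, whose coordinates lie in T and are killed by s'; so the maps scaled by s' are additive
   and p^-1-linear. *)
have key (e : 'I_N -> R) : \sum_j e j ^+ p * h j = 0 ->
    forall i, s' * \sum_j e j * c j i = 0.
  move=> e0 i; apply: s'T; apply: (indep (fun i => \sum_j e j * c j i)).
  have : s ^+ p * \sum_j e j ^+ p * h j = 0 by rewrite e0 mulr0.
  rewrite mulr_sumr => se0; apply: etrans se0.
  under [RHS]eq_bigr => j _ do rewrite mulrCA sE mulr_sumr.
  rewrite exchange_big; apply: eq_bigr => {}i _ /=.
  rewrite (frobp_sum charR) mulr_suml; apply: eq_bigr => j _.
  by rewrite exprMn mulrA.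
have [b bE] := choice hP.
have /choice[phi phiP] : forall i, exists phi : {additive R -> R},
    forall x, phi x = s' * \sum_j b x j * c j i.
  move=> i; apply: additive_of => x y; apply/eqP; rewrite -subr_eq0; apply/eqP.
  rewrite -!mulrBr -!sumrB.
  under eq_bigr => j _ do rewrite -!mulrBl.
  apply: key; under eq_bigr => j _ do rewrite !(frobpB charR) !mulrBl.
  by rewrite !sumrB -!bE subrr.
exists (s' * s); first exact: primeNM.
exists 'I_n, phi, g; split=> [i r y|x].
  rewrite !phiP; apply/eqP; rewrite -subr_eq0 mulrCA -mulrBr mulr_sumr -sumrB; apply/eqP.
  under eq_bigr => j _ do rewrite mulrA -mulrBl.
  apply: key; under eq_bigr => j _ do rewrite (frobpB charR) mulrBl exprMn -mulrA.
  by rewrite !sumrB -mulr_sumr -!bE expn1 subrr.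
rewrite expn1 {1}(bE x) exprMn -mulrA mulr_sumr.
under eq_bigr => j _ do rewrite mulrCA sE mulr_sumr.
rewrite exchange_big mulr_sumr; apply: eq_bigr => i _ /=.
rewrite phiP exprMn -mulrA; congr (_ * _).
rewrite (frobp_sum charR) mulr_suml; apply: eq_bigr => j _.
by rewrite exprMn mulrA.
Qed.

End DualBasis.

Section Kunz.
Variables (p : nat) (R : comNzRingType) (charR : p \in [pchar R]).

Definition dual_basis e := exists (T : finType)
    (phi : T -> {additive R -> R}) (g : T -> R),
  (forall i, root_linear p e (phi i)) /\
  forall x, x = \sum_i phi i x ^+ (p ^ e) * g i.

Lemma dual_basis_iter : dual_basis 1 -> forall e, dual_basis e.
Proof.
move=> [T [phi [g [lphi phiE]]]]; elim=> [|e [T' [psi [h [lpsi psiE]]]]].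
  exists unit, (fun=> idfun), (fun=> 1); split=> [i r y|x] /=.
    by rewrite expn0 expr1.
  by rewrite (big_pred1 tt) => [|[]//]; rewrite expn0 expr1 mulr1.
exists (T' * T)%type, (fun ij => phi ij.2 \o psi ij.1).
exists (fun ij => g ij.2 ^+ (p ^ e) * h ij.1); split=> [[i j] r y|x] /=.
  by rewrite expnS exprM lpsi -[p in r ^+ p]expn1 lphi.
rewrite {1}(psiE x) -(pair_bigA _ (fun i j => phi j (psi i x) ^+ (p ^ e.+1) *
  (g j ^+ (p ^ e) * h i))) /=.
apply: eq_bigr => i _; rewrite {1}(phiE (psi i x)) (frob_sum charR) mulr_suml.
by apply: eq_bigr => j _; rewrite exprMn -exprM -expnD mulrA.
Qed.

Theorem kunz : F_finite p R -> regular_ring R -> forall e, dual_basis e.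
Proof.
move=> FR [nR regR]; apply: dual_basis_iter.
have [T [phi [g [lphi phiE]]]] : scaled_dual_basis p 1 (1 : R).
  have idD := @scaled_dual_basis_ideal p R charR 1.
  apply: contrapT => D1; have [P prP DP] := prime_above nR idD D1.
  have [c Pc] := local_dual_basis charR nR FR (regR P prP).
  by move/DP.
by exists T, phi, g; split=> // x; rewrite -phiE expr1n mul1r.
Qed.

End Kunz.

(** * Frobenius roots *)

Section FrobeniusRoots.
Variables (p : nat) (R : comPzRingType).
Implicit Types (A B I J : set R).

Lemma mem_frobenius_root A e (phi : {additive R -> R}) y :
  root_linear p e phi -> A y -> frobenius_root p A e (phi y).
Proof.
by move=> lphi Ay; exists 1%N, (fun=> phi), (fun=> y); split=> //; rewrite big_ord1.
Qed.

Lemma frobenius_root_sub A e J : is_ideal J ->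
  (forall (phi : {additive R -> R}) y, root_linear p e phi -> A y -> J (phi y)) ->
  frobenius_root p A e `<=` J.
Proof. by move=> idJ AJ _ [n [phi [y [lphi Ay ->]]]]; apply: idl_sum => // i _; apply: AJ. Qed.

Lemma frobenius_root_ideal A e : is_ideal (frobenius_root p A e).
Proof.
split.
- by exists 0%N, (fun=> idfun), (fun=> 0); split=> [[]//|[]//|]; rewrite big_ord0.
- move=> x y [n [phi [u [lphi Au ->]]]] [m [psi [v [lpsi Av ->]]]].
  exists (n + m)%N, (fun i => match fintype.split i with inl j => phi j | inr j => psi j end).
  exists (fun i => match fintype.split i with inl j => u j | inr j => v j end).
  split=> [i|i|]; try by case: fintype.split.
  by rewrite -sum_split; apply: eq_bigr => i _; case: fintype.split.
- move=> r x [n [phi [y [lphi Ay ->]]]].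
  have /choice[psi psiP] : forall i, exists psi : {additive R -> R},
      root_linear p e psi /\ forall x, psi x = r * phi i x.
    by move=> i; apply: root_linear_mull.
  exists n, psi, y; split=> [i|//|]; first by case: (psiP i).
  by rewrite mulr_sumr; apply: eq_bigr => i _; case: (psiP i) => _ ->.
Qed.

Lemma frobenius_root_mono A B e : A `<=` B ->
  frobenius_root p A e `<=` frobenius_root p B e.
Proof.
by move=> AB _ [n [phi [y [lphi Ay ->]]]]; exists n, phi, y; split=> // i; apply: AB.
Qed.

Definition frobenius_power J e : set R :=
  ideal_gen [set x | exists2 y, J y & x = y ^+ (p ^ e)].

Lemma frobenius_power_ideal J e : is_ideal (frobenius_power J e).
Proof. exact: ideal_gen_ideal. Qed.

Lemma mem_frobenius_power J e y : J y -> frobenius_power J e (y ^+ (p ^ e)).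
Proof. by move=> Jy; apply: sub_ideal_gen; exists y. Qed.

Lemma frobenius_power_mono J I e : J `<=` I ->
  frobenius_power J e `<=` frobenius_power I e.
Proof. by move=> JI; apply: ideal_gen_mono => _ [y /JI Iy ->]; exists y. Qed.

Lemma frobenius_power_iter J e f :
  frobenius_power J (e + f) `<=` frobenius_power (frobenius_power J e) f.
Proof.
apply: ideal_gen_sub => [|_ [y Jy ->]]; first exact: frobenius_power_ideal.
by rewrite expnD exprM; apply: mem_frobenius_power; apply: mem_frobenius_power.
Qed.

Lemma frobenius_power_exp J n e :
  ideal_exp (frobenius_power J e) n `<=` frobenius_power (ideal_exp J n) e.
Proof.
rewrite ideal_exp_gen; elim: n => [|n IH].
  move=> x _; rewrite -[x]mulr1; apply: (idlMl (frobenius_power_ideal _ _)).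
  by rewrite -(expr1n _ (p ^ e)); apply: mem_frobenius_power.
apply: ideal_mul_sub; first exact: frobenius_power_ideal.
move=> _ y [c Jc ->] /IH[k [r [g [Jg ->]]]]; rewrite mulr_sumr.
apply: (idl_sum (frobenius_power_ideal _ _)) => i _.
have [d Jd ->] := Jg i; rewrite mulrCA -exprMn.
apply: (idlMl (frobenius_power_ideal _ _)); apply: mem_frobenius_power.
exact: mem_ideal_expS.
Qed.

Lemma root_linear_frobenius_power J e (phi : {additive R -> R}) y : is_ideal J ->
  root_linear p e phi -> frobenius_power J e y -> J (phi y).
Proof.
move=> idJ lphi [n [r [g [Jg ->]]]]; rewrite raddf_sum; apply: idl_sum => // i _.
by have [z Jz ->] := Jg i; rewrite mulrC lphi; apply: idlMr.
Qed.

Lemma frobenius_root_sub_power A e J : is_ideal J ->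
  A `<=` frobenius_power J e -> frobenius_root p A e `<=` J.
Proof.
move=> idJ AJ; apply: frobenius_root_sub => // phi y lphi /AJ.
exact: root_linear_frobenius_power.
Qed.

End FrobeniusRoots.

(** * Frobenius roots along a ring morphism *)

Section BaseChange.
Variables (p : nat) (R : comNzRingType) (S : comPzRingType) (h : {rmorphism R -> S}).

Lemma ideal_exp_image (a : set R) n :
  ideal_exp (h @` a) n `<=` ideal_gen (h @` ideal_exp a n).
Proof.
have idG m : is_ideal (ideal_gen (h @` ideal_exp a m)) by apply: ideal_gen_ideal.
elim: n => [|n IH].
  move=> x _; rewrite -[x]mulr1 -(rmorph1 h); apply: (idlMl (idG 0%N)).
  by apply: sub_ideal_gen; exists 1.
apply: ideal_mul_sub => // _ y [c ac <-] /IH[k [r [g [ag ->]]]]; rewrite mulr_sumr.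
apply: (idl_sum (idG n.+1)) => i _; have [d ad <-] := ag i.
rewrite mulrCA -rmorphM; apply: (idlMl (idG n.+1)); apply: sub_ideal_gen.
by exists (c * d) => //; apply: mem_ideal_expS.
Qed.

Lemma mem_ideal_exp_image (a : set R) n y :
  ideal_exp a n y -> ideal_exp (h @` a) n (h y).
Proof.
elim: n y => // n IH y; rewrite ideal_expS => -[k [f [g [af ag ->]]]].
rewrite rmorph_sum; apply: (idl_sum (ideal_exp_ideal _ _)) => i _; rewrite rmorphM.
by apply: mem_ideal_expS; [exists (f i) | exact: IH].
Qed.

(** Only a dual basis of R enters: expanding y in it turns psi(r h(y)) into the sum of h(phi_j y)
    psi(r h(g_j)). *)
Lemma frobenius_root_image (a : set R) e n : dual_basis p R e ->
  frobenius_root p (ideal_exp (h @` a) n) e `<=`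
  ideal_gen (h @` frobenius_root p (ideal_exp a n) e).
Proof.
move=> [T [phi [g [lphi phiE]]]].
have idG := ideal_gen_ideal (h @` frobenius_root p (ideal_exp a n) e).
apply: frobenius_root_sub => // psi _ lpsi /ideal_exp_image[k [r [u [au ->]]]].
rewrite raddf_sum; apply: (idl_sum idG) => i _; have [y ay <-] := au i.
rewrite (phiE y) rmorph_sum mulr_sumr raddf_sum; apply: (idl_sum idG) => j _.
rewrite rmorphM rmorphXn mulrCA lpsi; apply: (idlMr idG); apply: sub_ideal_gen.
by exists (phi j y) => //; apply: mem_frobenius_root.
Qed.

End BaseChange.

(** * The exponents ceil(t p^e) *)

Section Levels.
Variables (K : realType) (p : nat) (p1 : (1 < p)%N).
Implicit Types (t : K).

Definition level t e := `|Num.ceil (t * p%:R ^+ e)|%N.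

Lemma level_le t e n : 0 <= t -> (level t e <= n)%N = (t * p%:R ^+ e <= n%:R).
Proof.
move=> t0; have te0 : 0 <= t * p%:R ^+ e by rewrite mulr_ge0 ?exprn_ge0.
rewrite -lez_nat gez0_abs ?ceil_le_int //.
by rewrite ceil_ge0 (lt_le_trans _ te0) // ltrN10.
Qed.

Lemma le_level t e : 0 <= t -> t * p%:R ^+ e <= (level t e)%:R.
Proof. by move=> t0; rewrite -level_le. Qed.

Lemma level_lt t e : 0 <= t -> (level t e)%:R < t * p%:R ^+ e + 1.
Proof.
move=> t0; rewrite -ltrBlDr ltNge; apply/negP => h.
have : (level t e <= level t e - 1)%N.
  rewrite level_le //; apply: le_trans h _.
  by case: (level t e) => [|n]; rewrite ?sub0n ?subr_le0 ?ler01 // subn1 /= -natr1 addrK.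
case: (level t e) h => [|n]; last by rewrite subn1 ltnn.
rewrite sub0r => h _; have : 0 <= t * p%:R ^+ e by rewrite mulr_ge0 ?exprn_ge0.
by move=> /le_trans/(_ h); rewrite ler0N1.
Qed.

Lemma level_mono t t' e : 0 <= t -> t <= t' -> (level t e <= level t' e)%N.
Proof.
move=> t0 tt'; rewrite level_le //; apply: le_trans (le_level e _).
  by rewrite ler_wpM2r // exprn_ge0.
exact: le_trans tt'.
Qed.

Lemma levelD t e f : 0 <= t -> (level t (e + f) <= level t e * p ^ f)%N.
Proof.
by move=> t0; rewrite level_le // natrM natrX exprD mulrA ler_wpM2r ?exprn_ge0 ?le_level.
Qed.

Lemma levelM t e n : 0 <= t -> (level (n%:R * t) e <= n * level t e)%N.
Proof.
move=> t0; rewrite level_le ?mulr_ge0 // natrM -mulrA ler_wpM2l //.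
exact: le_level.
Qed.

Lemma level_nat n e : level n%:R e = (n * p ^ e)%N.
Proof. by rewrite /level -natrX -natrM pmulrn intrKceil. Qed.

Lemma level_frac n e : level (n%:R / p%:R ^+ e) e = n.
Proof.
rewrite /level divfK ?pmulrn ?intrKceil //.
by rewrite expf_neq0 // pnatr_eq0 -lt0n ltnW.
Qed.

Lemma level_gt0 t e : 0 < t -> (0 < level t e)%N.
Proof.
move=> t0; rewrite ltnNge (level_le _ _ (ltW t0)) -ltNge.
by rewrite mulr_gt0 // exprn_gt0 // ltr0n ltnW.
Qed.

(** Rounding up costs less than 1 in each of n terms, so a gain of n + c suffices; (t' - n t) p^f
    reaches it, since p^f exceeds f. *)
Lemma level_approx t t' n c : 0 <= t -> n%:R * t < t' ->
  exists f0, forall f, (f0 <= f)%N -> (n * level t f + c <= level t' f)%N.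
Proof.
move=> t0 tt'; pose d := t' - n%:R * t; have d0 : 0 < d by rewrite subr_gt0.
have t'0 : 0 <= t' by apply: ltW (le_lt_trans _ tt'); rewrite mulr_ge0.
exists (Num.bound ((n + c)%:R / d)) => f lef; rewrite -(ler_nat K).
apply: le_trans (le_level f t'0).
have q0 : 0 <= (p%:R : K) ^+ f by rewrite exprn_ge0.
have big : (n + c)%:R <= d * p%:R ^+ f.
  rewrite mulrC -ler_pdivrMr //; apply: le_trans (ltW (archi_boundP _)) _.
    by rewrite divr_ge0 // ltW.
  by rewrite -natrX ler_nat; apply: leq_trans lef (ltnW (ltn_expl _ p1)).
have := ltW (level_lt f t0); have n0 : 0 <= (n%:R : K) by [].
move=> /(ler_wpM2l n0); rewrite natrD natrM => h.
apply: le_trans (lerD h (lexx c%:R)) _.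
have -> : t' = d + n%:R * t by rewrite subrK.
move: big; rewrite natrD; lra.
Qed.

End Levels.

(** * Test ideals *)

Section FrobeniusDescent.
Variables (p : nat) (R : comNzRingType) (charR : p \in [pchar R]).
Hypothesis dual : forall e, dual_basis p R e.
Implicit Types (A J a : set R).

Lemma sub_frobenius_power_root A e :
  A `<=` frobenius_power p (frobenius_root p A e) e.
Proof.
have [T [phi [g [lphi phiE]]]] := dual e; move=> y Ay; rewrite (phiE y).
apply: (idl_sum (frobenius_power_ideal _ _ _)) => i _.
apply: (idlMr (frobenius_power_ideal _ _ _)); apply: mem_frobenius_power.
exact: mem_frobenius_root.
Qed.

Lemma frobenius_pure J f y : is_ideal J ->
  frobenius_power p J f (y ^+ (p ^ f)) -> J y.
Proof.
move=> idJ Jy; have [T [phi [g [lphi phiE]]]] := dual f.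
(* Expand 1 in the dual basis and multiply by y; one factor phi_i(1) absorbs y, because y phi_i(1) =
   phi_i(y^q). *)
have -> : y = \sum_i (phi i 1 ^+ (p ^ f).-1 * g i) * phi i (y ^+ (p ^ f)).
  rewrite -{1}[y]mulr1 {1}(phiE 1) mulr_sumr; apply: eq_bigr => i _.
  have q0 : (p ^ f = (p ^ f).-1.+1)%N.
    by rewrite prednK // expn_gt0 prime_gt0 // (pcharf_prime charR).
  have -> : phi i (y ^+ (p ^ f)) = y * phi i 1 by rewrite -lphi mulr1.
  by rewrite {1}q0 exprS; move: (_ ^+ _.-1) => z; ring.
apply: idl_sum => // i _; apply: idlMl => //.
exact: root_linear_frobenius_power (lphi i) Jy.
Qed.

(** For y in a^n, the power y^(p^f) lies in J^[p^(e+f)], which is contained in (J^[p^e])^[p^f];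
    purity removes the outer Frobenius power. *)
Lemma frobenius_root_incr a n e f :
  frobenius_root p (ideal_exp a n) e `<=`
  frobenius_root p (ideal_exp a (n * p ^ f)) (e + f).
Proof.
set J := frobenius_root p _ (e + f); have idJ : is_ideal J by apply: frobenius_root_ideal.
apply: frobenius_root_sub_power => // y ay.
apply: (frobenius_pure (frobenius_power_ideal _ _ _) (f := f)).
apply: frobenius_power_iter; apply: sub_frobenius_power_root.
exact: mem_ideal_expX.
Qed.

Lemma frobenius_root_mul a n m e :
  frobenius_root p (ideal_exp a (n * m)) e `<=`
  ideal_exp (frobenius_root p (ideal_exp a n) e) m.
Proof.
apply: frobenius_root_sub_power; first exact: ideal_exp_ideal.
rewrite -ideal_exp_exp.
apply: subset_trans (@frobenius_power_exp p _ _ m e).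
by apply: ideal_exp_mono; apply: sub_frobenius_power_root.
Qed.

(* Tight closure is trivial in a regular ring, tested against u itself.        *)
Lemma frobenius_tight_closure (nR : noetherian R) J u : is_ideal J ->
  (forall f, frobenius_power p J f (u ^+ (p ^ f) * u)) -> J u.
Proof.
move=> idJ tu; pose H := [set h | J (h * u)].
have idH : is_ideal H.
  split=> [|x y|r x]; rewrite /H /=.
  - by rewrite mul0r; apply: idl0.
  - by rewrite mulrDl; apply: idlD.
  - by rewrite -mulrA; apply: idlMl.
apply: contrapT => Ju; have H1 : ~ H 1 by rewrite /H /= mul1r.
have [P prP HP] := prime_above nR idH H1; have idP := prime_is_ideal prP.
(* Since u phi_i(u) = phi_i(u^q u) is in J, each phi_i(u) lies in H and so in P. Hence u is in P^[q]
   for every q, in particular in all powers of P. The resulting 1 - i is in H, contradicting that i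
   is in P. *)
have [i Pi uE] : exists2 i, P i & u = i * u.
  apply: (krull_intersection nR idP) => n.
  have lt_n : (n <= p ^ n)%N.
    by rewrite ltnW // ltn_expl // prime_gt1 // (pcharf_prime charR).
  apply: (ideal_exp_le lt_n).
  have [T [phi [g [lphi phiE]]]] := dual n; rewrite (phiE u).
  apply: (idl_sum (ideal_exp_ideal _ _)) => i _.
  apply: (idlMr (ideal_exp_ideal _ _)).
  have Pphi : P (phi i u).
    apply: HP; rewrite /H /= mulrC -lphi.
    exact: root_linear_frobenius_power (lphi i) (tu n).
  by have := @mem_ideal_expX _ P 1 (p ^ n) (phi i u); rewrite mul1n ideal_exp1 //; apply.
apply: (prime1 prP); apply: (idlBr idP Pi); apply: HP.
by rewrite /H /= mulrBl mul1r -uE subrr; apply: idl0.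
Qed.

End FrobeniusDescent.

Section TestIdeals.
Variables (K : realType) (p : nat) (R : comNzRingType) (charR : p \in [pchar R]).
Hypotheses (nR : noetherian R) (dual : forall e, dual_basis p R e).
Implicit Types (a b : set R) (t : K).

Let p1 : (1 < p)%N. Proof. by rewrite prime_gt1 // (pcharf_prime charR). Qed.

Lemma level_incr a t e f : 0 <= t ->
  frobenius_root p (ideal_exp a (level p t e)) e `<=`
  frobenius_root p (ideal_exp a (level p t (e + f))) (e + f).
Proof.
move=> t0; apply: subset_trans (@frobenius_root_incr _ _ charR dual a _ e f) _.
by apply/frobenius_root_mono/ideal_exp_le/levelD.
Qed.

Lemma level_test_ideal a t e :
  frobenius_root p (ideal_exp a (level p t e)) e `<=` test_ideal p a t.
Proof. by move=> x ax; exists e => //; exists 0%N => //; rewrite muln1 addn0. Qed.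

Lemma test_ideal_level a t x : 0 <= t -> test_ideal p a t x ->
  exists e, frobenius_root p (ideal_exp a (level p t e)) e x.
Proof.
move=> t0 [e _ [f _ ax]]; exists (e + f)%N; move: ax.
by apply/frobenius_root_mono/ideal_exp_le/levelD.
Qed.

Lemma test_ideal_stable a t : 0 <= t -> exists e0, forall e, (e0 <= e)%N ->
  test_ideal p a t = frobenius_root p (ideal_exp a (level p t e)) e.
Proof.
move=> t0; pose J e := frobenius_root p (ideal_exp a (level p t e)) e.
have incJ e : J e `<=` J e.+1 by rewrite -addn1; apply: level_incr.
have [N JN] := noeth_chain nR (fun e => frobenius_root_ideal _ _ _) incJ.
exists N => e Ne; apply/seteqP; split=> [x /test_ideal_level[//|f Jx]|]; last first.
  exact: level_test_ideal.
have JfN : J (f + N)%N = J e.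
  exact: etrans (JN _ (leq_addl _ _)) (esym (JN e Ne)).
rewrite -[X in X x]/(J e) -JfN; exact: (@level_incr a t f N t0 x Jx).
Qed.

Lemma test_ideal_ideal a t : 0 <= t -> is_ideal (test_ideal p a t).
Proof.
by move=> t0; have [e /(_ e (leqnn e)) ->] := test_ideal_stable a t0; apply: frobenius_root_ideal.
Qed.

Lemma test_ideal_monol a b t : a `<=` b -> test_ideal p a t `<=` test_ideal p b t.
Proof.
move=> ab x [e _ [f _ ax]]; exists e => //; exists f => //; move: ax.
exact/frobenius_root_mono/ideal_exp_mono.
Qed.

Lemma test_ideal_monor a t t' : 0 <= t' -> t' <= t ->
  test_ideal p a t `<=` test_ideal p a t'.
Proof.
move=> t'0 t't x /(test_ideal_level (le_trans t'0 t't))[e ax].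
apply: (level_test_ideal (e := e)); move: ax.
exact/frobenius_root_mono/ideal_exp_le/level_mono.
Qed.

Lemma test_ideal0 a : test_ideal p a (0 : K) = setT.
Proof.
apply/seteqP; split=> // x _; apply: (level_test_ideal (e := 0%N)).
have -> : level p (0 : K) 0 = 0%N by rewrite /level mul0r ceil0.
have id_linear : root_linear p 0 (idfun : {additive R -> R}) by move=> r y; rewrite expn0 expr1.
exact: (mem_frobenius_root id_linear).
Qed.

Theorem test_ideal_right_continuous a t : 0 < t -> is_ideal a -> exists2 eps : K, 0 < eps &
  test_ideal p a t `<=` test_ideal p a (t + eps).
Proof.
(* Exponents decreasing to t; their test ideals increase and stabilize at an ideal J containing
   every tau(a^t') with t' > t. *)
move=> t0 ida; pose s k : K := t + k.+1%:R^-1.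
have s_gt k : t < s k by rewrite ltrDl invr_gt0.
have s_ge0 k : 0 <= s k by rewrite ltW // (lt_trans t0).
have inc k : test_ideal p a (s k) `<=` test_ideal p a (s k.+1).
  apply: test_ideal_monor => //; rewrite lerD2l lef_pV2 ?posrE ?ltr0n //.
  by rewrite ler_nat.
have [N JN] := noeth_chain nR (fun k => test_ideal_ideal a (s_ge0 k)) inc.
set J := test_ideal p a (s N) in JN.
have idJ : is_ideal J by apply: test_ideal_ideal.
have supJ t' : t < t' -> test_ideal p a t' `<=` J.
  move=> tt'; pose k := (N + Num.bound (t' - t)^-1)%N.
  rewrite -(JN k (leq_addr _ _)); apply: test_ideal_monor => //.
  rewrite -lerBrDl invf_ple ?posrE ?subr_gt0 ?ltr0n //.
  have := archi_boundP (x := (t' - t)^-1).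
  rewrite invr_ge0 subr_ge0 (ltW tt') => /(_ isT)/ltW/le_trans; apply.
  by rewrite ler_nat leqW // leq_addl.
exists N.+1%:R^-1; first by rewrite invr_gt0.
have [e /(_ e (leqnn e)) ->] := test_ideal_stable a (ltW t0).
set n := level p t e; have n0 : (0 < n)%N by apply: level_gt0.
apply: frobenius_root_sub_power => // u au.
apply: (frobenius_tight_closure charR dual nR (frobenius_power_ideal _ _ _)) => f.
apply: frobenius_power_iter.
(* u^(p^f) u lies in a^(n p^f + 1), and the extra factor pushes this exponent strictly above t, as n
   / p^e is at least t. *)
pose t' : K := (n * p ^ f + 1)%:R / p%:R ^+ (e + f).
have q0 i : 0 < (p%:R : K) ^+ i by rewrite exprn_gt0 // ltr0n ltnW.
have tt' : t < t'.
  rewrite ltr_pdivlMr // exprD mulrA natrD natrM natrX.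
  by rewrite ltr_pwDr // ler_wpM2r ?(ltW (q0 f)) // le_level // ltW.
apply: (@frobenius_power_mono _ _
  (frobenius_root p (ideal_exp a (n * p ^ f + 1)) (e + f))).
  apply: subset_trans (supJ _ tt').
  by have := @level_test_ideal a t' (e + f); rewrite level_frac.
apply: (sub_frobenius_power_root dual); apply: mem_ideal_expD.
  exact: mem_ideal_expX.
by rewrite ideal_exp1 //; apply: ideal_exp_sub au.
Qed.

(* n * ceil(t p^f) + c is eventually at most ceil((n t + eps) p^f).            *)
Lemma test_ideal_perturb a (n c : nat) t : 0 < t -> (0 < n)%N -> is_ideal a ->
  exists f0, forall f, (f0 <= f)%N -> test_ideal p a (n%:R * t) `<=`
    frobenius_root p (ideal_exp a (n * level p t f + c)) f.
Proof.
move=> t0 n0 ida; have nt0 : 0 < n%:R * t by rewrite mulr_gt0 // ltr0n.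
have [eps eps0 sub] := test_ideal_right_continuous nt0 ida.
have nte0 : 0 <= n%:R * t + eps by rewrite addr_ge0 // ltW.
have [f1 stab] := test_ideal_stable a nte0.
have [|f2 approx] := @level_approx K p p1 t (n%:R * t + eps) n c (ltW t0).
  by rewrite ltrDl.
exists (maxn f1 f2) => f; rewrite geq_max => /andP[f1f f2f].
apply: subset_trans sub _; rewrite (stab f f1f).
exact/frobenius_root_mono/ideal_exp_le/approx.
Qed.

Theorem test_ideal_exp a n t : (0 < n)%N -> 0 < t -> is_ideal a ->
  test_ideal p (ideal_exp a n) t = test_ideal p a (n%:R * t).
Proof.
move=> n0 t0 ida; apply/seteqP; split=> [x /(test_ideal_level (ltW t0))[e ax]|].
  apply: (level_test_ideal (e := e)); move: ax; rewrite ideal_exp_exp.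
  by apply/frobenius_root_mono/ideal_exp_le/levelM/ltW.
have [f /(_ f (leqnn f)) sub] := test_ideal_perturb 0 t0 n0 ida.
apply: subset_trans sub _; rewrite addn0 -ideal_exp_exp; exact: level_test_ideal.
Qed.

(** Perturbation makes the exponent an exact multiple of ceil(t p^f), so that [frobenius_root_mul]
    can split off the power. *)
Theorem test_ideal_subadditive a n t : 0 <= t -> is_ideal a ->
  test_ideal p a (t * n%:R) `<=` ideal_exp (test_ideal p a t) n.
Proof.
rewrite le_eqVlt => /predU1P[<-|t0] ida; last case: n => [//|n].
  rewrite mul0r !test_ideal0 => x _; elim: n => // n IH.
  by rewrite -[x]mul1r; apply: mem_ideal_expS.
have [f /(_ f (leqnn f)) sub] := test_ideal_perturb 0 t0 (ltn0Sn n) ida.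
rewrite mulrC; apply: subset_trans sub _; rewrite addn0 mulnC.
apply: subset_trans (@frobenius_root_mul _ _ dual a _ _ f) _.
by apply: ideal_exp_mono; apply: level_test_ideal.
Qed.

End TestIdeals.

(** * Powers of the integral closure *)

Section IntegralClosure.
Variables (R : comPzRingType) (nR : noetherian R).
Implicit Types (A a : set R).

Lemma noeth_gen A : exists r (g : 'I_r -> R),
  (forall i, A (g i)) /\ ideal_gen A = ideal_gen (range g).
Proof.
pose Q M := exists r (g : 'I_r -> R), (forall i, A (g i)) /\ M = ideal_gen (range g).
have Q0 : Q (ideal_gen (range (fun i : 'I_0 => (0 : R)))).
  by exists 0%N, (fun=> 0); split=> // -[].
have [M [idM [r [g [Ag gE]]] maxM]] := noeth_max nR (ideal_gen_ideal _) Q0.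
exists r, g; split=> //; apply/seteqP; split; last first.
  by apply: ideal_gen_mono => _ [i _ <-].
rewrite -gE; apply: ideal_gen_sub => // x Ax.
pose g' (i : 'I_r.+1) := if unlift ord0 i is Some j then g j else x.
apply: (maxM (ideal_gen (range g'))); first exact: ideal_gen_ideal.
- exists r.+1, g'; split=> // i; rewrite /g'.
  by case: (unlift _ i).
- rewrite gE; apply: ideal_gen_mono => _ [i _ <-].
  by exists (lift ord0 i) => //; rewrite /g' liftK.
- by apply: sub_ideal_gen; exists ord0 => //; rewrite /g' unlift_none.
Qed.

Lemma sub_integral_closure a : is_ideal a -> a `<=` integral_closure a.
Proof.
move=> ida x ax; exists 1%N, (fun=> - x); split=> // [i|].
  by case: i => [|[|]] // _; rewrite ideal_exp1 //; apply: idlN.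
by rewrite big_nat1 subnn expr0 mulr1 expr1 subrr.
Qed.

Lemma integral_pow a x : is_ideal a -> integral_closure a x ->
  exists2 n, (0 < n)%N & ideal_mul a (ideal_exp (integral_closure a) n.-1) (x ^+ n).
Proof.
move=> ida ax; have [n [c [n0 ac /eqP]]] := ax; rewrite addr_eq0 => /eqP xE.
exists n => //; rewrite xE; set B := integral_closure a in ax *.
have idE : is_ideal (ideal_mul a (ideal_exp B n.-1)).
  by apply: ideal_mul_ideal; apply: ideal_exp_ideal.
apply: idlN => //; rewrite big_seq; apply: idl_sum => // i.
rewrite mem_index_iota ltnS => /andP[i0 lein].
have := ac i; rewrite i0 lein => /(_ isT).
case: i i0 lein => // i _ lein; rewrite ideal_expS => -[k [f [g [af ag ->]]]].
rewrite mulr_suml; apply: idl_sum => // j _; rewrite -mulrA.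
apply: mem_ideal_mul => //.
have -> : n.-1 = (i + (n - i.+1))%N by lia.
apply: mem_ideal_expD; first by apply: ideal_exp_mono (ag j); apply: sub_integral_closure.
exact: mem_ideal_exp_pow.
Qed.

(** The ideal a is a reduction of its closure B. A monomial of degree m + 1 + N in generators y_i
    contains some y_i^(c_i), which integral dependence trades for an element of a B^(c_i - 1); so
    B^(m+1+N) lies in a B^(m+N). *)
Lemma integral_closure_exp a : is_ideal a -> exists N, forall m,
  ideal_exp (integral_closure a) (m + N) `<=` ideal_exp a m.
Proof.
move=> ida; set B := integral_closure a.
have [r [y [By yE]]] := noeth_gen B.
have /choice[c cP] : forall i, exists n, (0 < n)%N /\
    ideal_mul a (ideal_exp B n.-1) (y i ^+ n).
  by move=> i; have [n] := integral_pow ida (By i); exists n.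
exists (\sum_i (c i).-1); elim=> // m IH; rewrite ideal_expS.
apply: (@subset_trans _ (ideal_mul a (ideal_exp B (m + \sum_i (c i).-1)))); last first.
  exact: ideal_mul_mono.
have idE k : is_ideal (ideal_mul a (ideal_exp B k)).
  by apply: ideal_mul_ideal; apply: ideal_exp_ideal.
rewrite -{1}(ideal_exp_gen B) yE ideal_exp_gen ideal_exp_words.
apply: ideal_gen_sub => // _ [w sw ->].
have c0 i : (0 < c i)%N by case: (cP i).
have [|i [w' [sw' ->]]] := @word_pigeonhole _ _ y c w c0.
  by rewrite sw addSn ltnS leq_addl.
have [_ [k [f [g [af Bg ->]]]]] := cP i; rewrite mulr_suml.
apply: idl_sum => // j _; rewrite -mulrA; apply: mem_ideal_mul => //.
have -> : (m + \sum_i (c i).-1)%N = ((c i).-1 + size w')%N.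
  by apply: succn_inj; rewrite -addSn -sw sw' -addSn prednK.
apply: mem_ideal_expD => //.
elim: (w') => // l v IHv; rewrite big_cons; exact: mem_ideal_expS.
Qed.

End IntegralClosure.

(** * Extending p^-e-linear maps to a localization *)

Section LocalizedRoots.
Variables (p : nat) (R : comNzRingType) (charR : p \in [pchar R]).
Variables (W : mulrClosed R) (e : nat) (phi : {additive R -> R}).
Hypothesis lphi : root_linear p e phi.
Local Notation loc := (tolocal W).
Local Notation q := (p ^ e)%N.

(** Writing r/w as r w^(q-1) / w^q makes the denominator a q-th power, which forces psi(r/w) = phi(r
    w^(q-1)) / w. *)
Lemma root_linear_localize : exists psi : {additive localization W -> localization W},
  root_linear p e psi /\ forall y, psi (loc y) = loc (phi y).
Proof.
have q0 : (q = q.-1.+1)%N.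
  by rewrite prednK // expn_gt0 prime_gt0 // (pcharf_prime charR).
have qX (x : R) : x * x ^+ q.-1 = x ^+ q by rewrite {2}q0 exprS.
have /choice[psi psiP] : forall z, exists z', forall r w, w \in W ->
    loc w * z = loc r -> loc w * z' = loc (phi (r * w ^+ q.-1)).
  move=> z; have [r0 [w0 [Ww0 e0]]] := tolocal_surj z.
  have [v vE] := tolocal_unit Ww0.
  exists (v * loc (phi (r0 * w0 ^+ q.-1))) => r w Ww e1.
  apply: (tolocal_cancel Ww0).
  have -> : loc w0 * (loc w * (v * loc (phi (r0 * w0 ^+ q.-1)))) =
      loc w0 * v * (loc w * loc (phi (r0 * w0 ^+ q.-1))) by ring.
  rewrite vE mul1r -!rmorphM -!lphi; apply/tolocal_eqP.
  have /tolocal_eqP[u Wu ue] : loc (w * r0) = loc (w0 * r).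
    by rewrite !rmorphM /= -e0 -e1; ring.
  exists u => //; rewrite -!lphi; congr (phi _).
  have -> : u ^+ q * (w ^+ q * (r0 * w0 ^+ q.-1)) =
      u ^+ q.-1 * w ^+ q.-1 * w0 ^+ q.-1 * (u * (w * r0)).
    by rewrite -!qX; move: (u ^+ _) (w ^+ _) (w0 ^+ _) => a b c; ring.
  rewrite ue -!qX; move: (u ^+ _) (w ^+ _) (w0 ^+ _) => a b c; ring.
have [|f fE] := @additive_of _ _ psi.
  move=> z1 z2; have [r1 [w1 [Ww1 e1]]] := tolocal_surj z1.
  have [r2 [w2 [Ww2 e2]]] := tolocal_surj z2.
  have Ww : w1 * w2 \in W by apply: rpredM.
  apply: (tolocal_cancel Ww); rewrite mulrBr.
  rewrite (psiP z1 (w2 * r1) _ Ww); last by rewrite !rmorphM /= -e1; ring.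
  rewrite (psiP z2 (w1 * r2) _ Ww); last by rewrite !rmorphM /= -e2; ring.
  rewrite (psiP _ (w2 * r1 - w1 * r2) _ Ww); last first.
    by rewrite rmorphB !rmorphM /= -e1 -e2; ring.
  by rewrite -rmorphB -raddfB mulrBl.
exists f; split=> [s z|y]; rewrite !fE; last first.
  apply: (@tolocal_cancel _ W 1); first exact: rpred1.
  rewrite (psiP _ y _ (rpred1 W)) ?expr1n ?mulr1 ?rmorph1 ?mul1r //.
have [b [v [Wv eb]]] := tolocal_surj s; have [r [w [Ww er]]] := tolocal_surj z.
have Wu : v ^+ q * w \in W by apply: rpredM => //; apply: rpredX.
apply: (tolocal_cancel Wu).
rewrite (psiP _ (b ^+ q * r) _ Wu); last first.
  by rewrite !rmorphM !rmorphXn /= -eb -er exprMn; ring.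
have -> : b ^+ q * r * (v ^+ q * w) ^+ q.-1 = (b * v ^+ q.-1) ^+ q * (r * w ^+ q.-1).
  by rewrite !exprMn -!exprM [(q * q.-1)%N]mulnC; ring.
rewrite lphi !rmorphM /= -(psiP z r w Ww er) -eb.
by rewrite -qX rmorphM /=; ring.
Qed.

End LocalizedRoots.

(** * Integral closure, Briançon-Skoda, localization and restriction *)

Section Consequences.
Variables (K : realType) (p : nat) (R : comNzRingType) (charR : p \in [pchar R]).
Hypotheses (nR : noetherian R) (dual : forall e, dual_basis p R e).
Implicit Types (a b : set R) (t : K).

Let p1 : (1 < p)%N. Proof. by rewrite prime_gt1 // (pcharf_prime charR). Qed.
Let q_gt0 e : (0 < p ^ e)%N. Proof. by rewrite expn_gt0 ltnW. Qed.

(** The constant N of [integral_closure_exp] is absorbed by [test_ideal_perturb], applied to the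
    ideal generated by the closure, whose powers are those of the closure. *)
Theorem test_ideal_integral_closure a t : is_ideal a -> 0 <= t ->
  test_ideal p (integral_closure a) t = test_ideal p a t.
Proof.
move=> ida; rewrite le_eqVlt => /predU1P[<-|t0]; first by rewrite !test_ideal0.
apply/seteqP; split; last exact/test_ideal_monol/sub_integral_closure.
have [N sub] := integral_closure_exp nR ida.
have [f /(_ f (leqnn f)) subB] :=
  test_ideal_perturb charR nR dual N t0 (ltn0Sn 0) (ideal_gen_ideal (integral_closure a)).
apply: (subset_trans (test_ideal_monol (@sub_ideal_gen _ _))).
move: subB; rewrite !mul1r mul1n => subB; apply: subset_trans subB _.
apply: (subset_trans _ (@level_test_ideal K p R a t f)).
by apply: frobenius_root_mono; rewrite ideal_exp_gen.
Qed.

Lemma skoda_level a r l e : generated_by a r -> (1 <= r)%N -> (r <= l)%N ->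
  frobenius_root p (ideal_exp a (l * p ^ e)) e `<=`
  ideal_mul a (frobenius_root p (ideal_exp a (l.-1 * p ^ e)) e).
Proof.
move=> [g ->] r1 rl; set J := ideal_mul _ _.
have idJ : is_ideal J by apply/ideal_mul_ideal/frobenius_root_ideal.
apply: frobenius_root_sub => // phi y lphi.
rewrite ideal_exp_gen ideal_exp_words => -[k [c [x [xP ->]]]].
rewrite raddf_sum; apply: idl_sum => // j _; have [w sw ->] := xP j.
have [//||i [w' [sw' ->]]] := @word_pigeonhole _ _ g (fun=> p ^ e)%N w.
  rewrite sum_nat_const card_ord sw; have := q_gt0 e; nia.
rewrite mulrCA lphi; apply: mem_ideal_mul; first by apply: sub_ideal_gen; exists i.
apply: mem_frobenius_root => //; apply: (idlMl (ideal_exp_ideal _ _)).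
rewrite ideal_exp_gen ideal_exp_words; apply: sub_ideal_gen; exists w' => //.
have := q_gt0 e; nia.
Qed.

Theorem test_ideal_skoda a r l : is_ideal a -> generated_by a r ->
  (1 <= r)%N -> (r <= l)%N ->
  test_ideal p a (l%:R : K) = ideal_mul a (test_ideal p a (l%:R - 1 : K)).
Proof.
move=> ida ga r1 rl; have l1 : (1 <= l)%N := leq_trans r1 rl.
have -> : l%:R - 1 = l.-1%:R :> K by rewrite -subn1 natrB.
have ge0 n : 0 <= n%:R :> K by [].
apply/seteqP; split=> [x /test_ideal_level[//|e]|].
  rewrite level_nat => /(skoda_level ga r1 rl).
  apply: ideal_mul_mono => // {}x ax; apply: (level_test_ideal (e := e)).
  by rewrite level_nat.
apply: ideal_mul_sub; first exact: test_ideal_ideal.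
move=> x z ax /test_ideal_level[//|e]; rewrite level_nat => az.
apply: (level_test_ideal (e := e)); rewrite level_nat.
have idT := frobenius_root_ideal p (ideal_exp a (l * p ^ e)) e.
(* For x in a, x phi(y) = phi(x^q y), and x^q contributes the missing q factors from a. *)
suff : frobenius_root p (ideal_exp a (l.-1 * p ^ e)) e `<=`
    [set z | frobenius_root p (ideal_exp a (l * p ^ e)) e (x * z)] by apply.
apply: frobenius_root_sub => [|phi y lphi ay].
  split=> [|u v|s u] /=.
  - by rewrite mulr0; apply: idl0.
  - by rewrite mulrDr; apply: idlD.
  - by rewrite mulrCA; apply: idlMl.
rewrite /= -lphi; apply: mem_frobenius_root => //.
have -> : (l * p ^ e = p ^ e + l.-1 * p ^ e)%N by have := q_gt0 e; nia.
by apply: mem_ideal_expD => //; apply: mem_ideal_exp_pow.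
Qed.

Theorem test_ideal_localize a (W : mulrClosed R) t : 0 <= t ->
  ideal_gen (tolocal W @` test_ideal p a t) =
  test_ideal p (ideal_gen (tolocal W @` a)) t.
Proof.
move=> t0; apply/seteqP; split.
  have [e /(_ e (leqnn e)) ->] := test_ideal_stable charR nR dual a t0.
  apply: (@subset_trans _
    (frobenius_root p (ideal_exp (ideal_gen (tolocal W @` a)) (level p t e)) e)); last first.
    by move=> x ax; exists e => //; exists 0%N => //; rewrite muln1 addn0.
  apply: ideal_gen_sub => [|_ [x ax <-]]; first exact: frobenius_root_ideal.
  have [n [phi [y [lphi ay ->]]]] := ax; rewrite rmorph_sum.
  apply: (idl_sum (frobenius_root_ideal _ _ _)) => i _.
  have [psi [lpsi psiE]] := root_linear_localize charR W (lphi i).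
  rewrite /= -psiE; apply: mem_frobenius_root => //.
  by rewrite ideal_exp_gen; apply: mem_ideal_exp_image.
move=> x [e _ [f _]]; rewrite ideal_exp_gen => /(frobenius_root_image (dual _)).
apply: ideal_gen_mono => _ [y ay <-]; exists y => //.
by exists e => //; exists f.
Qed.

(** Surjectivity makes the image of the test ideal an ideal, so the ideal generated by images in
    [frobenius_root_image] stays inside it. *)
Theorem test_ideal_restrict a (S : comPzRingType) (h : {rmorphism R -> S}) t :
  0 <= t -> (forall z, exists y, h y = z) ->
  test_ideal p (h @` a) t `<=` h @` test_ideal p a t.
Proof.
move=> t0 surj x [e _ [f _]] /(frobenius_root_image (dual _)).
apply: ideal_gen_sub => [|_ [y ay <-]]; last by exists y => //; exists e => //; exists f.
have idT := test_ideal_ideal charR nR dual a t0.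
split=> [|_ _ [y Ty <-] [z Tz <-]|r _ [y Ty <-]].
- by exists 0; rewrite ?rmorph0 //; apply: idl0.
- by exists (y + z); rewrite ?rmorphD //; apply: idlD.
- by have [s <-] := surj r; exists (s * y); rewrite ?rmorphM //; apply: idlMl.
Qed.

End Consequences.

Theorem theorem4p6 (K : realType) (p : nat) (R : comNzRingType)
    (charR : p \in [pchar R]) (FfinR : F_finite p R) (regR : regular_ring R)
    (a b : set R) (ida : is_ideal a) (idb : is_ideal b) :
  (* (1) *)
  (a `<=` b ->
     forall t : K, 0 < t -> test_ideal p a t `<=` test_ideal p b t) /\
  (* (2) *)
  (forall t t' : K, 0 <= t' -> t' <= t ->
     test_ideal p a t `<=` test_ideal p a t') /\
  (* (3) *)
  (forall (n : nat) (t : K), (0 < n)%N -> 0 < t ->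
     test_ideal p (ideal_exp a n) t = test_ideal p a (n%:R * t)) /\
  (* (4) *)
  (forall (W : mulrClosed R) (t : K), 0 <= t ->
     ideal_gen (tolocal W @` test_ideal p a t) =
     test_ideal p (ideal_gen (tolocal W @` a)) t) /\
  (* (5) *)
  (forall t : K, 0 <= t ->
     test_ideal p (integral_closure a) t = test_ideal p a t) /\
  (* (6) *)
  (forall t : K, 0 < t ->
     exists2 eps : K, 0 < eps &
       forall t' : K, t <= t' -> t' < t + eps ->
         test_ideal p a t' = test_ideal p a t) /\
  (* (7) *)
  (a `<=` test_ideal p a (1 : K)) /\
  (* (8) *)
  (forall r : nat, (1 <= r)%N -> generated_by a r ->
     forall l : nat, (r <= l)%N ->
       test_ideal p a (l%:R : K) =
       ideal_mul a (test_ideal p a ((l%:R : K) - 1))) /\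
  (* (9) *)
  (forall (x : R) (hx : ~ ring_unit x), regular_parameter hx ->
     forall t : K, 0 <= t ->
       test_ideal p (\pi_({ideal_quot (principal hx)})%qT @` a) t `<=`
       \pi_({ideal_quot (principal hx)})%qT @` test_ideal p a t) /\
  (* (10) *)
  (forall k : fieldType, perfect_field k -> ess_finite_type k R ->
     forall (t : K) (n : nat), 0 <= t ->
       test_ideal p a (t * n%:R) `<=` ideal_exp (test_ideal p a t) n).
Proof.
have nR : noetherian R by case: regR.
have dual := kunz charR FfinR regR.
split; [|split; [|split; [|split; [|split; [|split; [|split; [|split; [|split]]]]]]]].
- by move=> ab t _; apply: test_ideal_monol.
- exact: test_ideal_monor.
- by move=> n t n0 t0; apply: (test_ideal_exp charR nR dual).
- by move=> W t t0; apply: (test_ideal_localize charR nR dual).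
- by move=> t t0; apply: (test_ideal_integral_closure charR nR dual).
- move=> t t0; have [eps eps0 sub] := test_ideal_right_continuous charR nR dual t0 ida.
  exists eps => // t' tt' t'eps; apply/seteqP; split.
    by apply: test_ideal_monor => //; apply: ltW.
  apply: subset_trans sub _; apply: test_ideal_monor; last exact: ltW.
  exact: le_trans (ltW t0) tt'.
(* At level 0 the exponent is 1 and the identity is an admissible map, so a itself appears in the
   union. *)
- move=> x ax; apply: (level_test_ideal (e := 0%N)).
  rewrite (level_nat K p 1 0) mul1n expn0 ideal_exp1 //.
  have id_linear : root_linear p 0 (idfun : {additive R -> R}).
    by move=> r y; rewrite expn0 expr1.
  exact: (mem_frobenius_root id_linear).
- by move=> r r1 ga l rl; exact: (test_ideal_skoda K charR nR dual ida ga r1 rl).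
- move=> x hx _ t t0; apply: (test_ideal_restrict charR nR dual) => // z.
  by exists (repr z); exact: reprK.
- by move=> k _ _ t n t0; apply: (test_ideal_subadditive charR nR dual).
Qed.
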